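(* For all integers $i>0$ and $n\ge 0$, $$H_i^{Leib}(P_n)=0,\qquad\text{where } P_n=\Gamma_{sh}^{Lie}([n],-).$$
   Context: $\Bbbk$ is a fixed commutative ground ring, $\Bbbk\text{-Mod}$ its category of modules, and $\otimes=\otimes_{\Bbbk}$. Put $[n]=\{0,1,\dots,n\}$. **The modules $Lie(I)$.** For a finite set $I$, $Lie(I)$ is the corresponding component of the operad $Lie$: the $\Bbbk$-module spanned by bracket monomials in variables $x_i$ ($i\in I$), each variable used exactly once, modulo antisymmetry $[a,b]=-[b,a]$ and Jacobi $[a,[b,c]]=[[a,b],c]-[[a,c],b]$ (applied to any sub-monomials). $Lie(\emptyset)=0$. **The category $\Gamma_{sh}^{Lie}$.** A shuffling surjection $\alpha:[n]\to[m]$ is a surjective map with $\alpha(0)=0$ and $\min\alpha^{-1}(i)<\min\alpha^{-1}(j)$ whenever $i<j$. The $\Bbbk$-linear category $\Gamma_{sh}^{Lie}$ has objects $[n]$, $n\ge 0$, and $$\Gamma_{sh}^{Lie}([n],[m])=\bigoplus_{\alpha}Lie(\alpha^{-1}(0))\otimes\cdots\otimes Lie(\alpha^{-1}(m)),$$ the sum being over shuffling surjections $\alpha:[n]\to[m]$. The composite of $(\alpha,f_0\otimes\cdots\otimes f_m):[n]\to[m]$ followed by $(\beta,g_0\otimes\cdots\otimes g_p):[m]\to[p]$ is $(\beta\alpha,h_0\otimes\cdots\otimes h_p)$ where $h_k$ is obtained from $g_k$ by substituting $f_i$ for $x_i$ for all $i\in\beta^{-1}(k)$ (operadic composition). **The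 morphisms $d_{i,j}$.** For $n\ge 0$ and $0\le i<j\le n+1$, $d_{i,j}\in\Gamma_{sh}^{Lie}([n+1],[n])$ is the element attached to the shuffling surjection $\alpha$ with $\alpha(j)=i$, $\alpha(l)=l$ for $l<j$, $\alpha(l)=l-1$ for $l>j$, with tensor factor $[x_i,x_j]\in Lie(\{i,j\})$ at $i$ and the identity $x_l$ at all other places. **Leibniz homology of a functor.** For a $\Bbbk$-linear functor $T:\Gamma_{sh}^{Lie}\to\Bbbk\text{-Mod}$, $C^{Leib}_m(T)=T([m])$ ($m\ge 0$), with differential $d=T\big(\sum_{0\le i<j\le m}(-1)^j d_{i,j}\big):T([m])\to T([m-1])$ (one has $d^2=0$); $H_*^{Leib}(T)$ is the homology of this complex. *)

(* Defs.v *)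
From HB Require Import structures.
From mathcomp Require Import all_boot all_algebra.
From mathcomp Require Import finmap boolp monalg zify.

Set Implicit Arguments.
Unset Strict Implicit.
Unset Printing Implicit Defensive.

Import GRing.Theory.
Local Open Scope ring_scope.
Local Open Scope quotient_scope.

Section QuotMod.
Variables (k : pzRingType) (V : lmodType k) (S : V -> Prop).

Inductive spanned : V -> Prop :=
| Spanned0 : spanned 0
| SpannedS c v w : S v -> spanned w -> spanned (c *: v + w).

Lemma spannedD v w : spanned v -> spanned w -> spanned (v + w).
Proof.
elim=> [|c u u' Su _ IH] sw; first by rewrite add0r.
by rewrite -addrA; apply: SpannedS => //; apply: IH.
Qed.

Lemma spannedZ a v : spanned v -> spanned (a *: v).
Proof.
elim=> [|c u u' Su _ IH]; first by rewrite scaler0; apply: Spanned0.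
by rewrite scalerDr scalerA; apply: SpannedS.
Qed.

Lemma spanned_gen v : S v -> spanned v.
Proof. by move=> Sv; rewrite -[v]addr0 -[v]scale1r; do 2?constructor. Qed.

Definition span_pred : {pred V} := fun v => `[< spanned v >].

Fact span_pred_closed : zmod_closed span_pred.
Proof.
split; first by apply/asboolP; apply: Spanned0.
move=> u v /asboolP su /asboolP sv; apply/asboolP.
by apply: spannedD => //; rewrite -scaleN1r; apply: spannedZ.
Qed.
HB.instance Definition _ := GRing.isZmodClosed.Build V span_pred span_pred_closed.

(* [V] modulo the submodule spanned by [S]. *)
Definition quot_mod := Quotient.quot span_pred.
HB.instance Definition _ := Choice.on quot_mod.

End QuotMod.

(* Locked: unification would otherwise unfold the quotient construction. *)
HB.lock Definition quot_pi (k : pzRingType) (V : lmodType k) (S : V -> Prop)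
  (v : V) : quot_mod S := \pi_(Quotient.quot (span_pred S)) v.
HB.lock Definition quot_repr (k : pzRingType) (V : lmodType k) (S : V -> Prop)
  (x : quot_mod S) : V := repr (x : Quotient.quot (span_pred S)).

Section QuotModStructure.
Variables (k : pzRingType) (V : lmodType k) (S : V -> Prop).
Local Notation pi := (quot_pi S).

Lemma quot_reprK (x : quot_mod S) : pi (quot_repr x) = x.
Proof. by rewrite quot_pi.unlock quot_repr.unlock; apply: reprK. Qed.

Lemma quot_piP u v : pi u = pi v <-> spanned S (u - v).
Proof.
rewrite quot_pi.unlock.
split=> [/eqP|suv]; first by rewrite -Quotient.idealrBE => /asboolP.
by apply/eqP; rewrite -Quotient.idealrBE; apply/asboolP.
Qed.

Lemma spanned_repr v : spanned S (quot_repr (pi v) - v).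
Proof. by apply/quot_piP; rewrite quot_reprK. Qed.

Definition quot_zero : quot_mod S := pi 0.
Definition quot_add (x y : quot_mod S) : quot_mod S :=
  pi (quot_repr x + quot_repr y).
Definition quot_opp (x : quot_mod S) : quot_mod S := pi (- quot_repr x).
Definition quot_scale (a : k) (x : quot_mod S) : quot_mod S :=
  pi (a *: quot_repr x).

Lemma quot_addE u v : quot_add (pi u) (pi v) = pi (u + v).
Proof.
rewrite /quot_add; apply/quot_piP.
by rewrite opprD addrACA; apply: spannedD; apply: spanned_repr.
Qed.
Lemma quot_oppE u : quot_opp (pi u) = pi (- u).
Proof.
rewrite /quot_opp; apply/quot_piP.
by rewrite -opprD -[X in spanned _ X]scaleN1r; apply: spannedZ; apply: spanned_repr.
Qed.
Lemma quot_scaleE a v : quot_scale a (pi v) = pi (a *: v).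
Proof.
rewrite /quot_scale; apply/quot_piP; rewrite -scalerBr.
by apply: spannedZ; apply: spanned_repr.
Qed.

Fact quot_addA : associative quot_add.
Proof.
move=> x y z; rewrite -[x]quot_reprK -[y]quot_reprK -[z]quot_reprK.
by rewrite !quot_addE addrA.
Qed.
Fact quot_addC : commutative quot_add.
Proof. by move=> x y; rewrite -[x]quot_reprK -[y]quot_reprK !quot_addE addrC. Qed.
Fact quot_add0 : left_id quot_zero quot_add.
Proof. by move=> x; rewrite /quot_zero -[x]quot_reprK quot_addE add0r. Qed.
Fact quot_addN : left_inverse quot_zero quot_opp quot_add.
Proof.
move=> x; rewrite /quot_zero -[x]quot_reprK quot_oppE quot_addE.
by rewrite addNr.
Qed.

HB.instance Definition _ := GRing.isZmodule.Build (quot_mod S)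
  quot_addA quot_addC quot_add0 quot_addN.

Fact quot_pi_is_zmod_morphism : zmod_morphism pi.
Proof. by move=> u v; rewrite -quot_addE -quot_oppE. Qed.

HB.instance Definition _ :=
  GRing.isZmodMorphism.Build V (quot_mod S) pi quot_pi_is_zmod_morphism.

Fact quot_scaleA a b x : quot_scale a (quot_scale b x) = quot_scale (a * b) x.
Proof. by rewrite -[x]quot_reprK !quot_scaleE scalerA. Qed.
Fact quot_scale1 : left_id 1 quot_scale.
Proof. by move=> x; rewrite -[x]quot_reprK quot_scaleE scale1r. Qed.
Fact quot_scaleDr : right_distributive quot_scale +%R.
Proof.
move=> a x y; rewrite -[x]quot_reprK -[y]quot_reprK.
by rewrite -raddfD !quot_scaleE scalerDr raddfD.
Qed.
Fact quot_scaleDl x : {morph quot_scale^~ x : a b / a + b}.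
Proof. by move=> a b; rewrite -[x]quot_reprK !quot_scaleE scalerDl raddfD. Qed.

HB.instance Definition _ := GRing.Zmodule_isLmodule.Build k (quot_mod S)
  quot_scaleA quot_scale1 quot_scaleDr quot_scaleDl.

Fact quot_pi_is_scalable : scalable pi.
Proof. by move=> a v; rewrite -quot_scaleE. Qed.
HB.instance Definition _ :=
  GRing.isScalable.Build k V (quot_mod S) *:%R pi quot_pi_is_scalable.

End QuotModStructure.

Section FreeMod.
Variables (k : pzRingType) (X : choiceType).

(* [monalg] makes [{malg k[X]}] an [lmodType] only over a nontrivial ring;
   the alias carries the module structure over every [k]. *)
Definition freemod := {malg k[X]}.
HB.instance Definition _ := GRing.Zmodule.on freemod.

Definition fm_scale (c : k) (g : freemod) : freemod :=
  \sum_(x <- msupp g) << c * g@_x *g x >>.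

Lemma fm_scaleE c g x : (fm_scale c g)@_x = c * g@_x.
Proof.
rewrite {2}[g]monalgE !raddf_sum mulr_sumr.
by apply/eq_bigr=> /= i _; rewrite !mcoeffU mulrnAr.
Qed.

Fact fm_scaleA a b g : fm_scale a (fm_scale b g) = fm_scale (a * b) g.
Proof. by apply/malgP=> x; rewrite !fm_scaleE mulrA. Qed.
Fact fm_scale1 : left_id 1 fm_scale.
Proof. by move=> g; apply/malgP=> x; rewrite !fm_scaleE mul1r. Qed.
Fact fm_scaleDr : right_distributive fm_scale +%R.
Proof. by move=> c g h; apply/malgP=> x; rewrite !(mcoeffD, fm_scaleE) mulrDr. Qed.
Fact fm_scaleDl g : {morph fm_scale^~ g : a b / a + b}.
Proof. by move=> a b; apply/malgP=> x; rewrite !(mcoeffD, fm_scaleE) mulrDl. Qed.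

HB.instance Definition _ := GRing.Zmodule_isLmodule.Build k freemod
  fm_scaleA fm_scale1 fm_scaleDr fm_scaleDl.

Definition fm_gen (x : X) : freemod := << 1 *g x >>.

Lemma fm_scale_gen c x : c *: fm_gen x = << c *g x >>.
Proof.
by apply/malgP=> y; rewrite [LHS]fm_scaleE !mcoeffU mulrnAr mulr1.
Qed.

Lemma freemodE (g : freemod) : g = \sum_(x <- msupp g) g@_x *: fm_gen x.
Proof. by rewrite {1}[g]monalgE; apply: eq_bigr => x _; rewrite fm_scale_gen. Qed.

Section Lift.
Variables (V : lmodType k) (phi : X -> V).

Definition fm_lift (g : freemod) : V := \sum_(x <- msupp g) g@_x *: phi x.

Lemma fm_liftw (g : freemod) (D : {fset X}) : (msupp g `<=` D)%fset ->
  fm_lift g = \sum_(x <- D) g@_x *: phi x.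
Proof.
move=> sgD; rewrite /fm_lift; apply: big_fset_incl => // x _ xg.
by rewrite mcoeff_outdom // scale0r.
Qed.

Fact fm_lift_is_linear : linear fm_lift.
Proof.
move=> c g h; pose D := (msupp (c *: g + h)%R `|` msupp g `|` msupp h)%fset.
rewrite !(@fm_liftw _ D) ?scaler_sumr; first last.
- by rewrite /D -fsetUA fsubsetUl.
- by rewrite /D -fsetUA fsetUCA fsubsetUl.
- by rewrite /D fsubsetUr.
rewrite -big_split; apply: eq_bigr => x _ /=.
by rewrite mcoeffD [(c *: g)@_x]fm_scaleE scalerDl scalerA.
Qed.
HB.instance Definition _ :=
  GRing.isLinear.Build k freemod V *:%R fm_lift fm_lift_is_linear.

Lemma fm_lift_gen x : fm_lift (fm_gen x) = phi x.
Proof.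
by rewrite (fm_liftw msuppU_le) big_seq_fset1 mcoeffUU scale1r.
Qed.
End Lift.
End FreeMod.

Section LinearProp.
Variables (k : pzRingType) (U V : lmodType k) (F : U -> V).
Hypothesis linF : linear F.
Lemma linD : {morph F : x y / x + y}.
Proof. by move=> x y; rewrite -[x]scale1r linF !scale1r. Qed.
Lemma lin0 : F 0 = 0.
Proof. by apply: (addrI (F 0)); rewrite -linD !addr0. Qed.
Lemma linZ c : {morph F : x / c *: x}.
Proof. by move=> x; rewrite -[c *: x]addr0 linF lin0 addr0. Qed.
Lemma linN : {morph F : x / - x}.
Proof. by move=> x; rewrite -scaleN1r linZ scaleN1r. Qed.
Lemma linB : {morph F : x y / x - y}.
Proof. by move=> x y; rewrite linD linN. Qed.
Lemma lin_sum I (r : seq I) P (E : I -> U) :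
  F (\sum_(i <- r | P i) E i) = \sum_(i <- r | P i) F (E i).
Proof. exact: (big_morph F linD lin0). Qed.
End LinearProp.

(* The module with generators [X] and relations [r = 0], [r] in [S]. *)
Section PresMod.
Variables (k : pzRingType) (X : choiceType) (S : freemod k X -> Prop).

Definition presmod : lmodType k := quot_mod S.
Definition pres_gen (x : X) : presmod := quot_pi S (fm_gen k x).

End PresMod.

HB.lock Definition pres_lift (k : pzRingType) (X : choiceType)
    (S : freemod k X -> Prop) (V : lmodType k) (phi : X -> V)
    (u : presmod S) : V := fm_lift phi (quot_repr u).

Section PresModTheory.
Variables (k : pzRingType) (X : choiceType) (S : freemod k X -> Prop).
Local Notation presmod := (presmod S).
Local Notation pres_gen := (pres_gen S).

Lemma pres_ind (P : presmod -> Prop) : P 0 ->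
  (forall c u v, P u -> P v -> P (c *: u + v)) ->
  (forall x, P (pres_gen x)) -> forall u, P u.
Proof.
move=> P0 PD Pg u; rewrite -[u]quot_reprK [quot_repr u]freemodE raddf_sum.
elim: (X in \sum_(i <- X) _) => [|x s IH]; first by rewrite big_nil.
by rewrite big_cons /= linearZ; apply: PD => //; apply: Pg.
Qed.

Lemma pres_ext (V : lmodType k) (F G : presmod -> V) : linear F -> linear G ->
  (forall x, F (pres_gen x) = G (pres_gen x)) -> F =1 G.
Proof.
move=> lF lG FG; apply: pres_ind => //; first by rewrite !lin0.
by move=> c u v Fu Fv; rewrite lF lG Fu Fv.
Qed.

Section Lift.
Variables (V : lmodType k) (phi : X -> V).
Hypothesis phiS : forall r, S r -> fm_lift phi r = 0.

Lemma pres_lift_pi g : pres_lift phi (quot_pi S g) = fm_lift phi g.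
Proof.
have sp w : spanned S w -> fm_lift phi w = 0.
  elim=> [|c v {}w Sv _ IH]; first by rewrite raddf0.
  by rewrite linearP /= IH phiS // scaler0 addr0.
apply/eqP; rewrite pres_lift.unlock -subr_eq0 -raddfB; apply/eqP/sp.
by apply/quot_piP; rewrite quot_reprK.
Qed.

Lemma pres_lift_linear : linear (pres_lift (S := S) phi).
Proof.
move=> c u v; rewrite -[u]quot_reprK -[v]quot_reprK -linearP.
by rewrite !pres_lift_pi linearP.
Qed.

Lemma pres_lift_gen x : pres_lift phi (pres_gen x) = phi x.
Proof. by rewrite pres_lift_pi fm_lift_gen. Qed.
End Lift.
End PresModTheory.

Section Tree.
Variable T : Type.
Inductive tree := Leaf of T | Node of tree & tree.

Fixpoint leaves t := if t is Node s u then leaves s ++ leaves u else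
  if t is Leaf x then [:: x] else [::].

(* A tree with a hole, that is, the position of a sub-monomial. *)
Inductive tctx := Hole | NodeL of tctx & tree | NodeR of tree & tctx.

Fixpoint plug c t := match c with
  | Hole => t
  | NodeL c' u => Node (plug c' t) u
  | NodeR u c' => Node u (plug c' t)
  end.

Fixpoint tree_encode t : GenTree.tree T := match t with
  | Leaf x => GenTree.Leaf x
  | Node s u => GenTree.Node 0 [:: tree_encode s; tree_encode u]
  end.
Fixpoint tree_decode (t : GenTree.tree T) : option tree := match t with
  | GenTree.Leaf x => Some (Leaf x)
  | GenTree.Node _ [:: s; u] =>
      if tree_decode s is Some s' then
        if tree_decode u is Some u' then Some (Node s' u') else None
      else None
  | _ => None
  end.
Lemma tree_encodeK : pcancel tree_encode tree_decode.
Proof. by elim=> //= s -> u ->. Qed.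
End Tree.
Arguments Hole {T}.
HB.instance Definition _ (T : eqType) := Equality.copy (tree T)
  (pcan_type (@tree_encodeK T)).
HB.instance Definition _ (T : choiceType) := Choice.copy (tree T)
  (pcan_type (@tree_encodeK T)).

Section Lie.
Variables (k : comPzRingType) (T : finType).
Implicit Types (A B C D : {set T}) (t s u : tree T) (c : tctx T).

Definition lset t : {set T} := [set x in leaves t].
Definition is_mon A t := uniq (leaves t) && (lset t == A).
Record mon A := Mon { mon_tree :> tree T; _ : is_mon A mon_tree }.
HB.instance Definition _ A := [isSub for @mon_tree A].
HB.instance Definition _ A := [Choice of mon A by <:].

(* The generator [t], or [0] if [t] is not a monomial in the variables of [A].
   All the trees in one of the relations below have the same leaves, so either
   all of them are monomials on [A] or the relation reads [0 = 0]. *)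
Definition fmon A t : freemod k (mon A) :=
  if insub t is Some m then fm_gen k m else 0.

Inductive lie_rel A : freemod k (mon A) -> Prop :=
| Antisym c s t : @lie_rel A
    (fmon A (plug c (Node s t)) + fmon A (plug c (Node t s)))
| Jacobi c s t u : @lie_rel A
    (fmon A (plug c (Node s (Node t u)))
     - fmon A (plug c (Node (Node s t) u))
     + fmon A (plug c (Node (Node s u) t))).

Definition Lie A : lmodType k := presmod (@lie_rel A).

Definition lie_mon A t : Lie A := quot_pi (@lie_rel A) (fmon A t).

Lemma lie_monN A t : ~~ is_mon A t -> lie_mon A t = 0.
Proof. by move=> tA; rewrite /lie_mon /fmon insubN // raddf0. Qed.

Lemma lie_ind A (P : Lie A -> Prop) : P 0 ->
  (forall a x y, P x -> P y -> P (a *: x + y)) ->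
  (forall t, is_mon A t -> P (lie_mon A t)) -> forall x, P x.
Proof.
move=> P0 PD Pg; apply: pres_ind => // m.
suff -> : pres_gen (@lie_rel A) m = lie_mon A m by apply/Pg/valP.
by rewrite /lie_mon /fmon valK.
Qed.

Lemma lie_ext A (V : lmodType k) (F G : Lie A -> V) : linear F -> linear G ->
  (forall t, is_mon A t -> F (lie_mon A t) = G (lie_mon A t)) -> F =1 G.
Proof.
move=> lF lG FG; apply: lie_ind => //; first by rewrite !lin0.
by move=> a x y Fx Fy; rewrite lF lG Fx Fy.
Qed.

Lemma lie_mon_anti A c s t :
  lie_mon A (plug c (Node s t)) = - lie_mon A (plug c (Node t s)).
Proof.
apply/eqP; rewrite -addr_eq0 -raddfD /= -(raddf0 (quot_pi (@lie_rel A))).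
by apply/eqP/quot_piP; rewrite subr0; apply/spanned_gen/Antisym.
Qed.

Lemma lie_mon_jacobi A c s t u : lie_mon A (plug c (Node s (Node t u))) =
  lie_mon A (plug c (Node (Node s t) u)) - lie_mon A (plug c (Node (Node s u) t)).
Proof.
apply/eqP; rewrite -subr_eq0 opprB addrCA addrC -raddfB -raddfD /=.
rewrite -(raddf0 (quot_pi (@lie_rel A))).
by apply/eqP/quot_piP; rewrite subr0; apply/spanned_gen/Jacobi.
Qed.

Lemma is_mon_perm A s t : perm_eq (leaves s) (leaves t) -> is_mon A s = is_mon A t.
Proof.
move=> st; rewrite /is_mon (perm_uniq st); congr (_ && (_ == _)).
by apply/setP=> x; rewrite !inE (perm_mem st).
Qed.

Lemma leaves_plug c s t : perm_eq (leaves s) (leaves t) ->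
  perm_eq (leaves (plug c s)) (leaves (plug c t)).
Proof. by move=> st; elim: c => //= c IH u; rewrite ?perm_cat2r ?perm_cat2l. Qed.

Lemma is_mon_anti A c s t :
  is_mon A (plug c (Node s t)) = is_mon A (plug c (Node t s)).
Proof. by apply/is_mon_perm/leaves_plug => /=; rewrite perm_catC. Qed.

Lemma is_mon_assoc A c s t u : is_mon A (plug c (Node s (Node t u))) =
  is_mon A (plug c (Node (Node s t) u)).
Proof. by apply/is_mon_perm/leaves_plug => /=; rewrite catA. Qed.

Lemma is_mon_AC A c s t u : is_mon A (plug c (Node s (Node t u))) =
  is_mon A (plug c (Node (Node s u) t)).
Proof.
by apply/is_mon_perm/leaves_plug => /=; rewrite -catA perm_cat2l perm_catC.
Qed.

Section Lift.
Variables (A : {set T}) (V : lmodType k) (F : tree T -> V).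

Definition lie_lift : Lie A -> V := pres_lift (fun m : mon A => F m).

Definition lie_compat :=
  (forall c s t, is_mon A (plug c (Node s t)) ->
     F (plug c (Node s t)) = - F (plug c (Node t s))) /\
  (forall c s t u, is_mon A (plug c (Node s (Node t u))) ->
     F (plug c (Node s (Node t u))) = F (plug c (Node (Node s t) u))
     - F (plug c (Node (Node s u) t))).

Hypothesis F_compat : lie_compat.

Lemma fm_lift_mon t :
  fm_lift (fun m : mon A => F m) (fmon A t) = if is_mon A t then F t else 0.
Proof.
rewrite /fmon; case: insubP => [m -> <-|/negbTE ->]; last by rewrite raddf0.
by rewrite fm_lift_gen.
Qed.

Lemma lie_lift_rel r : lie_rel r -> fm_lift (fun m : mon A => F m) r = 0.
Proof.
case: F_compat => Fa Fj; case=> [c s t|c s t u].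
  rewrite raddfD /= !fm_lift_mon is_mon_anti.
  case: (boolP (is_mon A _)) => m; last by rewrite addr0.
  by rewrite Fa ?addNr // is_mon_anti.
rewrite raddfD raddfB /= !fm_lift_mon -is_mon_assoc -is_mon_AC.
case: (boolP (is_mon A _)) => m; last by rewrite subr0 addr0.
by rewrite (Fj _ _ _ _ m) [X in X + _]addrAC subrr sub0r addNr.
Qed.

Lemma lie_lift_linear : linear lie_lift.
Proof. exact: pres_lift_linear lie_lift_rel. Qed.

Lemma lie_lift_mon t : is_mon A t -> lie_lift (lie_mon A t) = F t.
Proof.
by move=> m; rewrite /lie_lift (pres_lift_pi lie_lift_rel) fm_lift_mon m.
Qed.
End Lift.

(* The bracket of [Lie A] and [Lie B] when [D] is the disjoint union of [A] and
   [B], and zero otherwise. *)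
Definition lbr A B D (x : Lie A) (y : Lie B) : Lie D :=
  lie_lift (fun s => lie_lift (fun t => lie_mon D (Node s t)) y) x.

(* The identity when [A = D], which avoids transport along set equalities. *)
Definition recast A D : Lie A -> Lie D := lie_lift (lie_mon D).

Lemma recast_compat A D : lie_compat A (lie_mon D).
Proof. by split=> *; [apply: lie_mon_anti | apply: lie_mon_jacobi]. Qed.

Lemma lbr_compatr B D s : lie_compat B (fun t => lie_mon D (Node s t)).
Proof.
split=> [c t u _|c t u v _]; first exact: (lie_mon_anti D (NodeR s c)).
exact: (lie_mon_jacobi D (NodeR s c)).
Qed.

Lemma lbr_compatl A B D (y : Lie B) :
  lie_compat A (fun s => lie_lift (fun t => lie_mon D (Node s t)) y).
Proof.
have l s := lie_lift_linear (lbr_compatr B D s).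
split=> [c s t _|c s t u _]; elim/lie_ind: y => [|a x y Hx Hy|v vB].
- by rewrite !(lin0 (l _)) oppr0.
- by rewrite !l Hx Hy scalerN opprD.
- by rewrite !lie_lift_mon //; try exact: lbr_compatr;
    apply: (lie_mon_anti D (NodeL c v)).
- by rewrite !(lin0 (l _)) subr0.
- by rewrite !l Hx Hy scalerBr opprD addrACA.
- by rewrite !lie_lift_mon //; try exact: lbr_compatr;
    apply: (lie_mon_jacobi D (NodeL c v)).
Qed.

Lemma lbr_linearl A B D (y : Lie B) : linear (fun x : Lie A => lbr D x y).
Proof. exact: lie_lift_linear (lbr_compatl _ _ _). Qed.

Lemma lbrPl A B D a (x x' : Lie A) (y : Lie B) :
  lbr D (a *: x + x') y = a *: lbr D x y + lbr D x' y.
Proof. exact: lbr_linearl. Qed.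

Lemma lbr_linearr A B D (x : Lie A) : linear (fun y : Lie B => lbr D x y).
Proof.
move=> a y z; elim/lie_ind: x => [|b x x' Hx Hx'|s sA].
- by rewrite !(lin0 (lbr_linearl _ _)) scaler0 addr0.
- rewrite !lbrPl Hx Hx' !scalerDr !scalerA [b * a]mulrC.
  exact: addrACA.
rewrite /lbr !lie_lift_mon //; try exact: lbr_compatl.
exact: lie_lift_linear (lbr_compatr _ _ _) _ _ _.
Qed.

Lemma lbr0x A B D (y : Lie B) : lbr D (0 : Lie A) y = 0.
Proof. exact: (lin0 (lbr_linearl D y)). Qed.
Lemma lbrx0 A B D (x : Lie A) : lbr D x (0 : Lie B) = 0.
Proof. exact: (lin0 (lbr_linearr D x)). Qed.

Lemma lbrPr A B D a (x : Lie A) (y y' : Lie B) :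
  lbr D x (a *: y + y') = a *: lbr D x y + lbr D x y'.
Proof. exact: lbr_linearr. Qed.

Lemma lbrNl A B D (x : Lie A) (y : Lie B) : lbr D (- x) y = - lbr D x y.
Proof. exact: (linN (lbr_linearl D y)). Qed.
Lemma lbrNr A B D (x : Lie A) (y : Lie B) : lbr D x (- y) = - lbr D x y.
Proof. exact: (linN (lbr_linearr D x)). Qed.
Lemma lbrBl A B D (x x' : Lie A) (y : Lie B) :
  lbr D (x - x') y = lbr D x y - lbr D x' y.
Proof. exact: (linB (lbr_linearl D y)). Qed.
Lemma lbrBr A B D (x : Lie A) (y y' : Lie B) :
  lbr D x (y - y') = lbr D x y - lbr D x y'.
Proof. exact: (linB (lbr_linearr D x)). Qed.

Lemma recast_linear A D : linear (@recast A D).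
Proof. exact: lie_lift_linear (recast_compat _ _). Qed.

Lemma recastP A D a (x y : Lie A) :
  recast D (a *: x + y) = a *: recast D x + recast D y.
Proof. exact: recast_linear. Qed.

Lemma recast_id A (x : Lie A) : recast A x = x.
Proof.
elim/lie_ind: x => [|a x y Hx Hy|t tA]; first by rewrite (lin0 (@recast_linear _ _)).
  by rewrite recastP Hx Hy.
by rewrite /recast lie_lift_mon //; apply: recast_compat.
Qed.

Lemma lset_mon A t : is_mon A t -> lset t = A.
Proof. by case/andP=> _ /eqP. Qed.

Lemma lbr_mon A B D s t : lset s = A -> lset t = B ->
  lbr D (lie_mon A s) (lie_mon B t) = lie_mon D (Node s t).
Proof.
move=> sA tB; case us: (uniq (leaves s)); last first.
  rewrite lie_monN /is_mon ?us // lbr0x lie_monN //.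
  by rewrite /is_mon /= cat_uniq us.
case ut: (uniq (leaves t)); last first.
  rewrite (lie_monN (A := B)) /is_mon ?ut // lbrx0 lie_monN //.
  by rewrite /is_mon /= cat_uniq ut !andbF.
have ms : is_mon A s by rewrite /is_mon us sA /=.
have mt : is_mon B t by rewrite /is_mon ut tB /=.
rewrite /lbr lie_lift_mon ?ms //; last exact: lbr_compatl.
by rewrite lie_lift_mon ?mt //; apply: lbr_compatr.
Qed.

Lemma lbr_anti A B D (x : Lie A) (y : Lie B) : lbr D x y = - lbr D y x.
Proof.
elim/lie_ind: x => [|a x x' Hx Hx'|s sA].
- by rewrite lbr0x lbrx0 oppr0.
- by rewrite lbrPl lbrPr Hx Hx' scalerN opprD.
elim/lie_ind: y => [|a y y' Hy Hy'|t tB].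
- by rewrite lbr0x lbrx0 oppr0.
- by rewrite lbrPl lbrPr Hy Hy' scalerN opprD.
rewrite !lbr_mon ?(lset_mon sA) ?(lset_mon tB) //.
exact: (lie_mon_anti D Hole).
Qed.

Lemma lset_node s t : lset (Node s t) = lset s :|: lset t.
Proof. by apply/setP=> x; rewrite !inE mem_cat. Qed.

Lemma lbr_jacobi A B C D (x : Lie A) (y : Lie B) (z : Lie C) :
  lbr D x (lbr (B :|: C) y z) =
  lbr D (lbr (A :|: B) x y) z - lbr D (lbr (A :|: C) x z) y.
Proof.
have l0 := (lbr0x, lbrx0).
have l2 := (lbrPl, lbrPr).
elim/lie_ind: x => [|a x x' Hx Hx'|s sA].
- by rewrite !l0 subr0.
- by rewrite !l2 Hx Hx' scalerBr opprD addrACA.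
elim/lie_ind: y => [|a y y' Hy Hy'|t tB].
- by rewrite !l0 subr0.
- by rewrite !l2 Hy Hy' scalerBr opprD addrACA.
elim/lie_ind: z => [|a z z' Hz Hz'|u uC].
- by rewrite !l0 subr0.
- by rewrite !l2 Hz Hz' scalerBr opprD addrACA.
rewrite !lbr_mon ?lset_node ?(lset_mon sA) ?(lset_mon tB) ?(lset_mon uC) //.
exact: (lie_mon_jacobi D Hole).
Qed.

End Lie.

Section Subst.
Variables (k : comPzRingType) (J T : finType) (A : J -> {set T}).
Implicit Types (B : {set J}) (D : {set T}) (t s u : tree J) (c : tctx J).

Definition fam_cover B : {set T} := \bigcup_(j in B) A j.

Section Eval.
Variable f : forall j, Lie k (A j).

(* The value of the monomial [t] at [x_j := f j], and its linear extension, the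
   operadic composition. When the sets [A j], [j] in [B], are pairwise disjoint,
   the meaningful target [D] is their union. *)
Fixpoint lie_eval D t : Lie k D := match t with
  | Leaf j => recast D (f j)
  | Node s u => lbr D (lie_eval (fam_cover (lset s)) s) (lie_eval (fam_cover (lset u)) u)
  end.

Definition lsubst B D : Lie k B -> Lie k D := lie_lift (lie_eval D).

Lemma fam_coverU B B' : fam_cover (B :|: B') = fam_cover B :|: fam_cover B'.
Proof. exact: bigcup_setU. Qed.

Lemma lset_plug c s t : lset s = lset t -> lset (plug c s) = lset (plug c t).
Proof. by move=> st; elim: c => //= [c IH u|u c IH]; rewrite !lset_node IH. Qed.

Lemma eval_compat B D : lie_compat B (lie_eval D).
Proof.
split=> [c s t _|c s t u _].
  have e0 c' : lset (plug c' (Node s t)) = lset (plug c' (Node t s)).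
    by apply: lset_plug; rewrite !lset_node setUC.
  elim: c D => /= [|c IH u|u c IH] D; first exact: lbr_anti.
    by rewrite IH lbrNl e0.
  by rewrite IH lbrNr e0.
have e1 c' : lset (plug c' (Node s (Node t u))) = lset (plug c' (Node (Node s t) u)).
  by apply: lset_plug; rewrite !lset_node setUA.
have e2 c' : lset (plug c' (Node s (Node t u))) = lset (plug c' (Node (Node s u) t)).
  by apply: lset_plug; rewrite !lset_node -setUA [lset u :|: _]setUC.
elim: c D => /= [|c IH v|v c IH] D.
- by rewrite !lset_node !fam_coverU; exact: lbr_jacobi.
- by rewrite IH lbrBl -e1 -e2.
- by rewrite IH lbrBr -e1 -e2.
Qed.

Lemma lsubst_linear B D : linear (@lsubst B D).
Proof. exact: lie_lift_linear (eval_compat _ _). Qed.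

Lemma lsubst_comb B D a (x y : Lie k B) :
  lsubst D (a *: x + y) = a *: lsubst D x + lsubst D y.
Proof. exact: lsubst_linear. Qed.

Lemma lsubst0 B D : lsubst D (0 : Lie k B) = 0.
Proof. exact: (lin0 (@lsubst_linear B D)). Qed.

Lemma lsubst_mon B D t : is_mon B t -> lsubst D (lie_mon k B t) = lie_eval D t.
Proof. by move=> m; rewrite /lsubst lie_lift_mon //; apply: eval_compat. Qed.

Lemma lsubst_lbr B B' D (x : Lie k B) (y : Lie k B') : [disjoint B & B'] ->
  lsubst D (lbr (B :|: B') x y) =
  lbr D (lsubst (fam_cover B) x) (lsubst (fam_cover B') y).
Proof.
move=> BB'.
elim/lie_ind: x => [|a x x' Hx Hx'|s sB].
- by rewrite lbr0x !lsubst0 lbr0x.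
- by rewrite lbrPl !lsubst_comb lbrPl Hx Hx'.
elim/lie_ind: y => [|a y y' Hy Hy'|t tB'].
- by rewrite lbrx0 !lsubst0 lbrx0.
- by rewrite lbrPr !lsubst_comb lbrPr Hy Hy'.
rewrite lbr_mon ?(lset_mon sB) ?(lset_mon tB') //.
rewrite (lsubst_mon _ sB) (lsubst_mon _ tB') lsubst_mon /=.
  by rewrite (lset_mon sB) (lset_mon tB').
case/andP: (sB) => us /eqP eB; case/andP: (tB') => ut /eqP eB'.
rewrite /is_mon lset_node eB eB' eqxx andbT /= cat_uniq us ut /= andbT.
apply/hasPn=> z zt; apply: contraL BB' => zs; apply/pred0Pn; exists z => /=.
by rewrite -eB -eB' !inE zs zt.
Qed.

End Eval.

Implicit Types f g : forall j, Lie k (A j).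

Lemma eq_eval f g D t : {in leaves t, forall j, f j = g j} ->
  lie_eval f D t = lie_eval g D t.
Proof.
elim: t D => [j|s IHs u IHu] D /= ff'; first by rewrite ff' ?mem_head.
by congr lbr; [apply: IHs | apply: IHu] => j jt; rewrite ff' // mem_cat jt ?orbT.
Qed.

Lemma evalP j a f f1 f2 D t : uniq (leaves t) -> j \in leaves t ->
  f j = a *: f1 j + f2 j -> (forall i, i != j -> f i = f1 i) ->
  (forall i, i != j -> f i = f2 i) ->
  lie_eval f D t = a *: lie_eval f1 D t + lie_eval f2 D t.
Proof.
move=> + + fj f1E f2E; elim: t D => [i|s IHs u IHu] D /=.
  by rewrite inE => _ /eqP<-; rewrite fj recastP.
rewrite cat_uniq mem_cat => /and3P[us /hasPn su uu].
have Eout g v : (forall i, i != j -> f i = g i) -> j \notin leaves v ->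
    forall E, lie_eval g E v = lie_eval f E v.
  move=> fg jv E; apply: eq_eval => i iv; rewrite fg //.
  by apply: contraNneq jv => <-.
case: (boolP (j \in leaves s)) => [js _|js /= ju].
  have ju : j \notin leaves u by apply/negP => /su; rewrite /= js.
  by rewrite IHs // lbrPl !(Eout f1 u) // !(Eout f2 u).
by rewrite IHu // lbrPr !(Eout f1 s) // !(Eout f2 s).
Qed.

Lemma eq_lsubst f g B D (x : Lie k B) : {in B, forall j, f j = g j} ->
  lsubst f D x = lsubst g D x.
Proof.
move=> ff'; apply: (lie_ext (F := lsubst f D) (G := lsubst g D)) => [||t tB];
  try exact: lsubst_linear.
rewrite !lsubst_mon //; apply: eq_eval => j jt; apply: ff'.
by rewrite -(lset_mon tB) inE.
Qed.

Lemma lsubstP j a f f1 f2 B D (x : Lie k B) : j \in B ->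
  f j = a *: f1 j + f2 j -> (forall i, i != j -> f i = f1 i) ->
  (forall i, i != j -> f i = f2 i) ->
  lsubst f D x = a *: lsubst f1 D x + lsubst f2 D x.
Proof.
move=> jB fj f1E f2E.
apply: (lie_ext (F := lsubst f D)
  (G := fun x => a *: lsubst f1 D x + lsubst f2 D x)) => [||t tB].
- exact: lsubst_linear.
- move=> b y z; rewrite !lsubst_comb !scalerDr !scalerA [a * b]mulrC.
  exact: addrACA.
rewrite !lsubst_mon //; case/andP: tB => ut /eqP tB.
by apply: (evalP _ ut _ fj) => //; rewrite -tB inE in jB.
Qed.

End Subst.

Section LsubstTheory.
Variables (k : comPzRingType).

Lemma lsubst_id (T : finType) (A : T -> {set T}) (B D : {set T})
    (f : forall j, Lie k (A j)) (x : Lie k B) :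
  (forall j, A j = [set j]) -> (forall j, f j = lie_mon k (A j) (Leaf j)) ->
  lsubst f D x = recast D x.
Proof.
move=> A1 fE; have cA (C : {set T}) : fam_cover A C = C.
  apply/setP=> z; apply/bigcupP/idP => [[y yC]|zC].
    by rewrite A1 => /set1P->.
  by exists z => //; rewrite A1 set11.
suff ev t E : uniq (leaves t) -> lie_eval f E t = lie_mon k E t.
  apply: (lie_ext (F := lsubst f D) (G := recast D)) => [||t tB].
  - exact: lsubst_linear.
  - exact: recast_linear.
  rewrite lsubst_mon // ev; last by case/andP: tB.
  by rewrite /recast lie_lift_mon //; exact: recast_compat.
elim: t E => [j|s IHs u IHu] E /=.
  rewrite fE /recast lie_lift_mon //; first exact: recast_compat.
  by rewrite /is_mon A1 /=; apply/eqP/setP=> z; rewrite !inE.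
by rewrite cat_uniq => /and3P[us _ uu]; rewrite IHs // IHu // lbr_mon ?cA.
Qed.

Section LsubstLsubst.
Variables (K J T : finType) (A : J -> {set T}) (B : K -> {set J}) (A' : K -> {set T}).
Variables (f : forall j, Lie k (A j)) (g : forall i, Lie k (B i)).
Hypothesis A'E : forall i, A' i = fam_cover A (B i).
Hypothesis B_disj : forall i i', i != i' -> [disjoint B i & B i'].

Lemma fam_cover_comp C : fam_cover A (fam_cover B C) = fam_cover A' C.
Proof.
apply/setP=> z; apply/bigcupP/bigcupP => [[j /bigcupP[i iC jB] zA]|[i iC]].
  by exists i => //; rewrite A'E; apply/bigcupP; exists j.
rewrite A'E => /bigcupP[j jB zA]; exists j => //.
by apply/bigcupP; exists i.
Qed.

Lemma fam_cover1 (I S : finType) (E : I -> {set S}) i : fam_cover E (lset (Leaf i)) = E i.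
Proof.
apply/setP=> z; apply/bigcupP/idP => [[j]|zE]; last by exists i; rewrite ?inE.
by rewrite !inE => /eqP->.
Qed.

Lemma lsubst_eval t : uniq (leaves t) ->
  lsubst f (fam_cover A' (lset t)) (lie_eval g (fam_cover B (lset t)) t) =
  lie_eval (fun i => lsubst f (A' i) (g i)) (fam_cover A' (lset t)) t.
Proof.
elim: t => [i|s IHs u IHu] /=; first by rewrite !fam_cover1 !recast_id.
rewrite cat_uniq => /and3P[us /hasPn su uu].
rewrite !lset_node !fam_coverU lsubst_lbr; last first.
  rewrite -setI_eq0; apply/eqP/setP=> j; rewrite !inE; apply/negP.
  case/andP=> /bigcupP[i ti ji] /bigcupP[i' ti' ji']; rewrite !inE in ti ti'.
  have ii' : i != i' by apply: contraTneq ti => ->; apply: su.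
  by have /pred0P/(_ j)/= := B_disj ii'; rewrite ji ji'.
by rewrite !fam_cover_comp IHs // IHu.
Qed.

Lemma lsubst_lsubst (C : {set K}) E D (x : Lie k C) :
  E = fam_cover B C -> D = fam_cover A' C ->
  lsubst f D (lsubst g E x) = lsubst (fun i => lsubst f (A' i) (g i)) D x.
Proof.
move=> -> ->; elim/lie_ind: x => [|a x y Hx Hy|t tC].
- by rewrite !lsubst0.
- by rewrite !lsubst_comb Hx Hy.
rewrite !lsubst_mon //; case/andP: tC => ut /eqP <-.
exact: lsubst_eval.
Qed.
End LsubstLsubst.
End LsubstTheory.

Section Tensor.
Variables (k : comPzRingType) (I : finType) (M : I -> lmodType k).

Definition tens_gen := {dffun forall i, M i}.

(* [f] with its component at [i] replaced by [x]. *)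
Definition tens_upd (f : tens_gen) i (x : M i) : tens_gen :=
  [ffun j => dfwith f x j].

Inductive tens_rel : freemod k tens_gen -> Prop :=
| Multilin (f : tens_gen) i a (x y : M i) :
    tens_rel (fm_gen k (tens_upd f (a *: x + y))
              - (a *: fm_gen k (tens_upd f x) + fm_gen k (tens_upd f y))).

Definition tens : lmodType k := presmod tens_rel.

Definition tpure (f : tens_gen) : tens := pres_gen tens_rel f.

Definition multilinear (V : lmodType k) (phi : tens_gen -> V) :=
  forall (f : tens_gen) i a (x y : M i),
    phi (tens_upd f (a *: x + y)) = a *: phi (tens_upd f x) + phi (tens_upd f y).

Definition tens_lift (V : lmodType k) (phi : tens_gen -> V) : tens -> V :=
  pres_lift phi.

Lemma tpure_multilinear : multilinear tpure.
Proof.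
move=> f i a x y; apply/eqP; rewrite -subr_eq0 -linearP -raddfB /=.
rewrite -(raddf0 (quot_pi tens_rel)).
by apply/eqP/quot_piP; rewrite subr0; apply: spanned_gen.
Qed.

Lemma tens_ext (V : lmodType k) (F G : tens -> V) : linear F -> linear G ->
  (forall f, F (tpure f) = G (tpure f)) -> F =1 G.
Proof. exact: pres_ext. Qed.

Section Lift.
Variables (V : lmodType k) (phi : tens_gen -> V).
Hypothesis phiM : multilinear phi.

Lemma tens_lift_rel r : tens_rel r -> fm_lift phi r = 0.
Proof.
by case=> f i a x y; rewrite raddfB /= linearP /= !fm_lift_gen phiM subrr.
Qed.

Lemma tens_lift_linear : linear (tens_lift phi).
Proof. exact: pres_lift_linear tens_lift_rel. Qed.

Lemma tens_lift_pure f : tens_lift phi (tpure f) = phi f.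
Proof. exact: (pres_lift_gen tens_lift_rel). Qed.
End Lift.
End Tensor.

Section DirSum.
Variables (k : pzRingType) (A : finType) (M : A -> lmodType k).

Definition dirsum := {dffun forall a, M a}.
HB.instance Definition _ := Choice.on dirsum.
Implicit Types x y z : dirsum.

Definition dsum_zero : dirsum := [ffun a => 0].
Definition dsum_add x y : dirsum := [ffun a => x a + y a].
Definition dsum_opp x : dirsum := [ffun a => - x a].
Definition dsum_scale (c : k) x : dirsum := [ffun a => c *: x a].

Fact dsum_addA : associative dsum_add.
Proof. by move=> x y z; apply/ffunP=> a; rewrite !ffunE addrA. Qed.
Fact dsum_addC : commutative dsum_add.
Proof. by move=> x y; apply/ffunP=> a; rewrite !ffunE addrC. Qed.
Fact dsum_add0 : left_id dsum_zero dsum_add.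
Proof. by move=> x; apply/ffunP=> a; rewrite !ffunE add0r. Qed.
Fact dsum_addN : left_inverse dsum_zero dsum_opp dsum_add.
Proof. by move=> x; apply/ffunP=> a; rewrite !ffunE addNr. Qed.
HB.instance Definition _ := GRing.isZmodule.Build dirsum
  dsum_addA dsum_addC dsum_add0 dsum_addN.

Fact dsum_scaleA b c x : dsum_scale b (dsum_scale c x) = dsum_scale (b * c) x.
Proof. by apply/ffunP=> a; rewrite !ffunE scalerA. Qed.
Fact dsum_scale1 : left_id 1 dsum_scale.
Proof. by move=> x; apply/ffunP=> a; rewrite !ffunE scale1r. Qed.
Fact dsum_scaleDr : right_distributive dsum_scale +%R.
Proof. by move=> c x y; apply/ffunP=> a; rewrite !ffunE scalerDr. Qed.
Fact dsum_scaleDl x : {morph dsum_scale^~ x : b c / b + c}.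
Proof. by move=> b c; apply/ffunP=> a; rewrite !ffunE scalerDl. Qed.
HB.instance Definition _ := GRing.Zmodule_isLmodule.Build k dirsum
  dsum_scaleA dsum_scale1 dsum_scaleDr dsum_scaleDl.

Definition dinj a (u : M a) : dirsum := [ffun b => dfwith (fun b => 0 : M b) u b].

Lemma dsumP c x y a : (c *: x + y) a = c *: x a + y a.
Proof. by rewrite !ffunE. Qed.

Lemma dinj_linear a : linear (@dinj a).
Proof.
move=> c u v; apply/ffunP=> b; rewrite dsumP !ffunE.
have [<-|ab] := eqVneq a b; first by rewrite !dfwith_in.
by rewrite !dfwith_out // scaler0 addr0.
Qed.

Lemma dinj_in a (u : M a) : dinj u a = u.
Proof. by rewrite ffunE dfwith_in. Qed.

Lemma dinj_out a b (u : M a) : a != b -> dinj u b = 0.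
Proof. by move=> ab; rewrite ffunE dfwith_out. Qed.

Lemma dsum_sum x : x = \sum_a dinj (x a).
Proof.
have ev b (F : A -> dirsum) : (\sum_a F a) b = \sum_a F a b.
  by elim/big_rec2: _ => [|a y1 y2 _ <-]; rewrite ffunE.
apply/ffunP=> b; rewrite ev (bigD1 b) //= dinj_in big1 ?addr0 // => a ab.
exact: dinj_out.
Qed.

Lemma dsum_ext (V : lmodType k) (F G : dirsum -> V) : linear F -> linear G ->
  (forall a (u : M a), F (dinj u) = G (dinj u)) -> F =1 G.
Proof.
move=> lF lG FG x; rewrite (dsum_sum x) (lin_sum lF) (lin_sum lG).
by apply: eq_bigr => a _; apply: FG.
Qed.
End DirSum.

Lemma multilinear_comb (k : comPzRingType) (I : finType) (M : I -> lmodType k)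
    (V : lmodType k) (phi : tens_gen M -> V) (f f1 f2 : tens_gen M) i a :
  multilinear phi -> f i = a *: f1 i + f2 i ->
  (forall j, j != i -> f j = f1 j) -> (forall j, j != i -> f j = f2 j) ->
  phi f = a *: phi f1 + phi f2.
Proof.
move=> phiM fi f1E f2E.
have -> : f = tens_upd f (a *: f1 i + f2 i).
  apply/ffunP=> j; rewrite ffunE.
  by have [<-|ij] := eqVneq i j; rewrite ?dfwith_in // dfwith_out.
rewrite phiM; congr (_ *: phi _ + phi _); apply/ffunP=> j; rewrite ffunE.
  have [<-|ij] := eqVneq i j; first by rewrite dfwith_in.
  by rewrite dfwith_out // f1E // eq_sym.
have [<-|ij] := eqVneq i j; first by rewrite dfwith_in.
by rewrite dfwith_out // f2E // eq_sym.
Qed.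

Section Shuffling.
Variables n m : nat.
Implicit Type a : {ffun 'I_n.+1 -> 'I_m.+1}.

(* [n] is the neutral value here: every element of a fibre is at most [n]. *)
Definition fiber_min a (i : 'I_m.+1) : nat := \big[minn/n]_(x | a x == i) x.

Definition shuffling a :=
  [&& a ord0 == ord0, [forall i, exists x, a x == i] &
      [forall i : 'I_m.+1, forall j : 'I_m.+1,
         (i < j)%N ==> (fiber_min a i < fiber_min a j)%N]].

Record shuf := Shuf { shuf_fun :> {ffun 'I_n.+1 -> 'I_m.+1}; _ : shuffling shuf_fun }.
HB.instance Definition _ := [isSub for shuf_fun].
HB.instance Definition _ := [Finite of shuf by <:].

Definition fiber a (i : 'I_m.+1) : {set 'I_n.+1} := [set x | a x == i].

Lemma fiber_min_le a x : (fiber_min a (a x) <= x)%N.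
Proof.
rewrite /fiber_min; have : x \in index_enum 'I_n.+1 by rewrite mem_index_enum.
elim: (index_enum _) => // y r IH; rewrite inE big_cons => /orP[/eqP<-|/IH].
  by rewrite eqxx geq_minl.
by case: ifP => // _ xr; rewrite geq_min xr orbT.
Qed.

Lemma fiber_minP a x : exists2 y, a y = a x & fiber_min a (a x) = y.
Proof.
have [E|//] : fiber_min a (a x) = n \/ exists2 y, a y = a x & fiber_min a (a x) = y.
  rewrite /fiber_min; elim/big_rec: _ => [|y u /eqP ayx]; first by left.
  move=> IH; right; rewrite /minn; case: ltnP => yu; first by exists y.
  case: IH => // un; exists y => //; apply/eqP.
  by rewrite eqn_leq yu un -ltnS ltn_ord.
exists x => //; apply/eqP; rewrite eqn_leq fiber_min_le E.
by rewrite -ltnS ltn_ord.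
Qed.

End Shuffling.

Lemma shufflingP n m (a : {ffun 'I_n.+1 -> 'I_m.+1}) :
  reflect [/\ a ord0 = ord0, forall i, exists x, a x = i &
    forall i j : 'I_m.+1, (i < j)%N -> (fiber_min a i < fiber_min a j)%N]
  (shuffling a).
Proof.
apply: (iffP and3P) => -[/eqP a0 sa ma]; split=> //.
- by move=> i; have /existsP[x /eqP] := forallP sa i; exists x.
- by move=> i j ij; apply: (implyP (forallP (forallP ma i) j)).
- by apply/forallP=> i; have [x ax] := sa i; apply/existsP; exists x; apply/eqP.
- by apply/forallP=> i; apply/forallP=> j; apply/implyP; apply: ma.
Qed.

Section ShufCat.
Variables n m p : nat.

Fact shuf_id_proof : shuffling [ffun x : 'I_n.+1 => x].
Proof.
apply/shufflingP; split=> [|i|i j ij]; first by rewrite ffunE.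
  by exists i; rewrite ffunE.
have id_min l : fiber_min [ffun x : 'I_n.+1 => x] l = l.
  have [y] := fiber_minP [ffun x : 'I_n.+1 => x] l.
  by rewrite !ffunE => -> ->.
by rewrite !id_min.
Qed.
Definition shuf_id : shuf n n := Shuf shuf_id_proof.

Variables (a : shuf n m) (b : shuf m p).

Fact shuf_comp_proof : shuffling [ffun x => b (a x)].
Proof.
have /shufflingP[a0 sa ma] := valP a; have /shufflingP[b0 sb mb] := valP b.
rewrite /= in a0 sa ma b0 sb mb; set c := finfun _.
have cE x : c x = b (a x) by rewrite ffunE.
apply/shufflingP; split=> [|i|i j ij]; first by rewrite cE a0.
  by have [y <-] := sb i; have [x <-] := sa y; exists x; rewrite cE.
have [y' ei] := sb i; have [x' ex'] := sa y'; have [y'' ej] := sb j.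
have [x'' ex''] := sa y''.
have cx' : c x' = i by rewrite cE ex'.
have cx'' : c x'' = j by rewrite cE ex''.
have [u] := fiber_minP b y'; rewrite ei => bu mu.
have [z] := fiber_minP c x''; rewrite cx'' => cz ->.
have lt_ua : (u < a z)%N.
  rewrite -mu; apply: leq_trans (mb _ _ ij) _.
  by rewrite -cz cE; apply: fiber_min_le.
have [w aw] := sa u; have [v] := fiber_minP a w; rewrite aw => av mv.
have cv : c v = i by rewrite cE av.
rewrite -cv; apply: leq_ltn_trans (fiber_min_le c v) _.
by rewrite -mv; apply: leq_trans (ma _ _ lt_ua) (fiber_min_le a z).
Qed.
(* [b] after [a] *)
Definition shuf_comp : shuf n p := Shuf shuf_comp_proof.
End ShufCat.

Section Hom.
Variable k : comPzRingType.

Definition Hom n m : lmodType k :=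
  dirsum (fun a : shuf n m => tens (fun i => Lie k (fiber a i))).

Definition pure n m (a : shuf n m)
    (f : tens_gen (fun i => Lie k (fiber a i))) : Hom n m :=
  dinj (tpure f).

Definition hom_id n : Hom n n :=
  pure (a := shuf_id n) [ffun i => lie_mon k _ (Leaf i)].

Definition comp_pure n m p (a : shuf n m) (b : shuf m p)
    (f : tens_gen (fun i => Lie k (fiber a i)))
    (g : tens_gen (fun i => Lie k (fiber b i))) : Hom n p :=
  pure (a := shuf_comp a b) [ffun l => lsubst f _ (g l)].

Definition comp_purel n m p (a : shuf n m) (b : shuf m p)
    (f : tens_gen (fun i => Lie k (fiber a i)))
    (v : tens (fun i => Lie k (fiber b i))) : Hom n p :=
  tens_lift (fun g => comp_pure f g) v.

Definition comp_tens n m p (a : shuf n m) (b : shuf m p)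
    (u : tens (fun i => Lie k (fiber a i)))
    (v : tens (fun i => Lie k (fiber b i))) : Hom n p :=
  tens_lift (fun f => comp_purel f v) u.

(* [x] followed by [y], extending bilinearly the formula of [comp_pure]. *)
Definition hom_comp n m p (x : Hom n m) (y : Hom m p) : Hom n p :=
  \sum_(a : shuf n m) \sum_(b : shuf m p) comp_tens (x a) (y b).

Lemma pure_comb n m (a : shuf n m) (f f1 f2 : tens_gen (fun i => Lie k (fiber a i)))
    i c : f i = c *: f1 i + f2 i ->
  (forall j, j != i -> f j = f1 j) -> (forall j, j != i -> f j = f2 j) ->
  pure f = c *: pure f1 + pure f2.
Proof.
move=> fi f1E f2E; rewrite /pure -dinj_linear; congr dinj.
exact: multilinear_comb (@tpure_multilinear _ _ _) fi f1E f2E.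
Qed.

Lemma hom_ext n m (V : lmodType k) (F G : Hom n m -> V) : linear F -> linear G ->
  (forall (a : shuf n m) f, F (pure (a := a) f) = G (pure f)) -> F =1 G.
Proof.
move=> lF lG FG; apply: dsum_ext => // a.
have lcomp (H : Hom n m -> V) : linear H -> linear (fun u => H (dinj (a := a) u)).
  by move=> lH c u v; rewrite dinj_linear lH.
by apply: tens_ext (lcomp _ lF) (lcomp _ lG) _ => f; apply: FG.
Qed.

Section Comp.
Variables n m p : nat.
Variables (a : shuf n m) (b : shuf m p).
Local Notation Gen c := (tens_gen (fun i => Lie k (fiber c i))).

Lemma comp_pure_multir (f : Gen a) :
  multilinear (fun g : Gen b => comp_pure f g).
Proof.
move=> g i c x y; apply: (pure_comb (i := i)).
- by rewrite !ffunE !dfwith_in lsubst_comb.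
- by move=> j ji; rewrite !ffunE !dfwith_out // eq_sym.
- by move=> j ji; rewrite !ffunE !dfwith_out // eq_sym.
Qed.

Lemma comp_purelP (f : Gen a) c x y :
  comp_purel (b := b) f (c *: x + y) = c *: comp_purel f x + comp_purel f y.
Proof. exact: tens_lift_linear (comp_pure_multir f) c x y. Qed.

Lemma comp_purel0 (f : Gen a) : comp_purel (b := b) f 0 = 0.
Proof. exact: lin0 (tens_lift_linear (comp_pure_multir f)). Qed.

Lemma comp_purel_pure (f : Gen a) (g : Gen b) :
  comp_purel f (tpure g) = comp_pure f g.
Proof. exact: tens_lift_pure (comp_pure_multir f) g. Qed.

Lemma comp_pure_multil (v : tens (fun i => Lie k (fiber b i))) :
  multilinear (fun f : Gen a => comp_purel f v).
Proof.
move=> f i c x y; elim/pres_ind: v => [|d v w Hv Hw|g].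
- by rewrite !comp_purel0 scaler0 addr0.
- rewrite !comp_purelP Hv Hw !scalerDr !scalerA [d * c]mulrC; exact: addrACA.
rewrite -/(tpure g) !comp_purel_pure.
have out w w' j : j != i -> tens_upd f (i := i) w j = tens_upd f (i := i) w' j.
  by move=> ji; rewrite !ffunE !dfwith_out // eq_sym.
apply: (pure_comb (i := b i)) => [|j ji|j ji]; rewrite !ffunE.
- apply: (lsubstP (j := i)) => [||j|j]; first by rewrite inE.
  + by rewrite !ffunE !dfwith_in.
  + exact: out.
  + exact: out.
- by apply: eq_lsubst => j'; rewrite inE => /eqP bj'; apply: out;
    apply: contraNneq ji => <-; rewrite bj'.
- by apply: eq_lsubst => j'; rewrite inE => /eqP bj'; apply: out;
    apply: contraNneq ji => <-; rewrite bj'.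
Qed.

Lemma comp_tensPl c x y (v : tens (fun i => Lie k (fiber b i))) :
  comp_tens (a := a) (c *: x + y) v = c *: comp_tens x v + comp_tens y v.
Proof. exact: tens_lift_linear (comp_pure_multil v) c x y. Qed.

Lemma comp_tens0l (v : tens (fun i => Lie k (fiber b i))) :
  comp_tens (a := a) 0 v = 0.
Proof. exact: lin0 (tens_lift_linear (comp_pure_multil v)). Qed.

Lemma comp_tens_purel (f : Gen a) (v : tens (fun i => Lie k (fiber b i))) :
  comp_tens (tpure f) v = comp_purel f v.
Proof. exact: tens_lift_pure (comp_pure_multil v) f. Qed.

Lemma comp_tensPr (u : tens (fun i => Lie k (fiber a i))) c x y :
  comp_tens (b := b) u (c *: x + y) = c *: comp_tens u x + comp_tens u y.
Proof.
elim/pres_ind: u => [|d v w Hv Hw|f].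
- by rewrite !comp_tens0l scaler0 addr0.
- rewrite !comp_tensPl Hv Hw !scalerDr !scalerA [d * c]mulrC; exact: addrACA.
by rewrite -/(tpure f) !comp_tens_purel comp_purelP.
Qed.

Lemma comp_tens0r (u : tens (fun i => Lie k (fiber a i))) :
  comp_tens (b := b) u 0 = 0.
Proof. exact: lin0 (fun c x y => comp_tensPr u c x y). Qed.

Lemma comp_tens_pure (f : Gen a) (g : Gen b) :
  comp_tens (tpure f) (tpure g) = comp_pure f g.
Proof. by rewrite comp_tens_purel comp_purel_pure. Qed.
End Comp.

Section CompHom.
Variables n m p : nat.

Lemma hom_compPl c (x y : Hom n m) (z : Hom m p) :
  hom_comp (c *: x + y) z = c *: hom_comp x z + hom_comp y z.
Proof.
rewrite scaler_sumr -big_split; apply: eq_bigr => a _ /=.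
rewrite scaler_sumr -big_split; apply: eq_bigr => b _ /=.
by rewrite dsumP comp_tensPl.
Qed.

Lemma hom_compPr (x : Hom n m) c (y z : Hom m p) :
  hom_comp x (c *: y + z) = c *: hom_comp x y + hom_comp x z.
Proof.
rewrite scaler_sumr -big_split; apply: eq_bigr => a _ /=.
rewrite scaler_sumr -big_split; apply: eq_bigr => b _ /=.
by rewrite dsumP comp_tensPr.
Qed.

Lemma hom_comp_pure (a : shuf n m) (b : shuf m p)
    (f : tens_gen (fun i => Lie k (fiber a i)))
    (g : tens_gen (fun i => Lie k (fiber b i))) :
  hom_comp (pure f) (pure g) = comp_pure f g.
Proof.
rewrite /hom_comp (bigD1 a) //= [X in _ + X]big1 ?addr0 => [|a' aa']; last first.
  by rewrite big1 // => b' _; rewrite dinj_out ?comp_tens0l // eq_sym.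
rewrite (bigD1 b) //= [X in _ + X]big1 ?addr0 => [|b' bb']; last first.
  by rewrite (dinj_out (a := b)) ?comp_tens0r // eq_sym.
by rewrite !dinj_in comp_tens_pure.
Qed.
End CompHom.

Lemma pure_recast n m (a b : shuf n m)
    (f : tens_gen (fun i => Lie k (fiber a i))) : b = a ->
  pure (a := b) [ffun l => recast (fiber b l) (f l)] = pure f.
Proof.
by move->; congr pure; apply/ffunP=> l; rewrite ffunE recast_id.
Qed.

Lemma fiber_id n (l : 'I_n.+1) : fiber (shuf_id n) l = [set l].
Proof. by apply/setP=> x; rewrite !inE ffunE. Qed.

Lemma fiber_comp n m p (a : shuf n m) (b : shuf m p) l :
  fiber (shuf_comp a b) l = fam_cover (fiber a) (fiber b l).
Proof.
apply/setP=> x; rewrite !inE ffunE; apply/idP/bigcupP => [bax|[i]].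
  by exists (a x); rewrite ?inE.
by rewrite !inE => bi /eqP ->.
Qed.

Lemma hom_compx1 n m (x : Hom n m) : hom_comp x (hom_id m) = x.
Proof.
apply: (hom_ext (F := fun x => hom_comp x (hom_id m)) (G := fun x => x)) => //.
  by move=> c u v; rewrite hom_compPl.
move=> a f; rewrite /hom_id hom_comp_pure /comp_pure.
rewrite -[RHS](@pure_recast _ _ _ (shuf_comp a (shuf_id m))).
  congr pure; apply/ffunP=> l; rewrite !ffunE lsubst_mon //.
  by rewrite /is_mon fiber_id /=; apply/eqP/setP=> z; rewrite !inE.
by apply/val_inj/ffunP=> z; rewrite !ffunE.
Qed.

Lemma hom_comp1x n m (x : Hom n m) : hom_comp (hom_id n) x = x.
Proof.
apply: (hom_ext (F := hom_comp (hom_id n)) (G := fun x => x)) => //.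
  by move=> c u v; rewrite hom_compPr.
move=> a f; rewrite /hom_id hom_comp_pure /comp_pure.
rewrite -[RHS](@pure_recast _ _ _ (shuf_comp (shuf_id n) a)).
  congr pure; apply/ffunP=> l; rewrite !ffunE; apply: lsubst_id => j.
    exact: fiber_id.
  by rewrite ffunE.
by apply/val_inj/ffunP=> z; rewrite !ffunE.
Qed.

Lemma hom_compA n m p q (x : Hom n m) (y : Hom m p) (z : Hom p q) :
  hom_comp (hom_comp x y) z = hom_comp x (hom_comp y z).
Proof.
move: x; apply: hom_ext.
- by move=> c u v; rewrite !hom_compPl.
- by move=> c u v; rewrite hom_compPl.
move=> a f; move: y; apply: hom_ext.
- by move=> c u v; rewrite hom_compPr hom_compPl.
- by move=> c u v; rewrite hom_compPl hom_compPr.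
move=> b g; move: z; apply: hom_ext.
- by move=> c u v; rewrite hom_compPr.
- by move=> c u v; rewrite !hom_compPr.
move=> c h; rewrite !hom_comp_pure /comp_pure.
have e : shuf_comp (shuf_comp a b) c = shuf_comp a (shuf_comp b c).
  by apply/val_inj/ffunP=> x; rewrite !ffunE.
have := fiber_comp (shuf_comp a b) c; move: (shuf_comp _ c) e => d -> fE.
congr pure; apply/ffunP=> l; rewrite !ffunE.
rewrite (@lsubst_lsubst _ _ _ _ (fiber a) (fiber b) (fiber (shuf_comp a b))) //.
- by apply: eq_lsubst => i _; rewrite ffunE.
- exact: fiber_comp.
- move=> i j ij; apply/pred0P=> x /=; rewrite !inE.
  by apply/negP=> /andP[/eqP-> /eqP e']; rewrite e' eqxx in ij.
- exact: fiber_comp.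
Qed.
End Hom.

(* For [i < j <= n + 1], the surjection [n + 1] -> [n] that sends [j] to [i] and
   is increasing on the other elements; [lift j] is its increasing section. *)
Section Merge.
Variables (n : nat) (j : 'I_n.+2) (i : 'I_j).

Definition merge_fun : {ffun 'I_n.+2 -> 'I_n.+1} :=
  [ffun l : 'I_n.+2 => inord (if l == j then i : nat
                               else if (l < j)%N then l : nat else l.-1)].

Lemma merge_funE l : merge_fun l =
  (if l == j then i : nat else if (l < j)%N then l : nat else l.-1) :> nat.
Proof.
have ij := ltn_ord i; have jn := ltn_ord j; have ln := ltn_ord l.
rewrite ffunE inordK //; case: eqP => [_|/eqP lj]; first by lia.
by rewrite -val_eqE /= in lj; case: ifP => lj'; lia.
Qed.

Lemma merge_lift p : merge_fun (lift j p) = p.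
Proof.
apply/val_inj; rewrite /= merge_funE -val_eqE /= /bump.
have ij := ltn_ord i; have jn := ltn_ord j; have pn := ltn_ord p.
by repeat case: ifP => /=; lia.
Qed.

Lemma merge_ge l : (lift j (merge_fun l) <= l)%N.
Proof.
rewrite /= /bump merge_funE -val_eqE /=.
have ij := ltn_ord i; have jn := ltn_ord j; have ln := ltn_ord l.
by repeat case: ifP => /=; lia.
Qed.

Lemma merge_fiber p : fiber merge_fun p =
  if p == i :> nat then [set lift j p; j] else [set lift j p].
Proof.
have ij := ltn_ord i; have jn := ltn_ord j; have pn := ltn_ord p.
apply/setP=> l; have ln := ltn_ord l; rewrite inE -val_eqE /= merge_funE.
by case: (p == i :> nat) / eqP => pi; rewrite !inE -!val_eqE /= /bump;
  repeat case: ifP => /=; lia.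
Qed.

Fact merge_proof : shuffling merge_fun.
Proof.
have fmin p : fiber_min merge_fun p = lift j p.
  have := fiber_min_le merge_fun (lift j p).
  have [y] := fiber_minP merge_fun (lift j p); rewrite merge_lift => ay ->.
  by move=> yp; apply/eqP; rewrite eqn_leq yp -{1}ay merge_ge.
apply/shufflingP; split=> [|p|p q pq]; last first.
- by rewrite !fmin /= /bump; lia.
- by exists (lift j p); apply: merge_lift.
apply/val_inj/eqP; rewrite -leqn0 /=.
by apply: leq_trans (merge_ge ord0); rewrite /= /bump leq_addl.
Qed.

Definition merge_shuf : shuf n.+1 n := Shuf merge_proof.

(* [lift j p] is [i] when [p] is [i]. *)
Definition merge_tree (p : 'I_n.+1) : tree 'I_n.+2 :=
  if p == i :> nat then Node (Leaf (lift j p)) (Leaf j) else Leaf (lift j p).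

Lemma merge_tree_mon p : is_mon (fiber merge_shuf p) (merge_tree p).
Proof.
rewrite /is_mon merge_fiber /merge_tree.
case: ifP => _ /=; last by apply/eqP/setP=> l; rewrite !inE.
rewrite inE eq_sym neq_lift /=.
by apply/eqP/setP=> l; rewrite !inE.
Qed.

Definition dmor (k : comPzRingType) : Hom k n.+1 n :=
  pure (a := merge_shuf) [ffun p => lie_mon k _ (merge_tree p)].
End Merge.

Section Leibniz.
Variable k : comPzRingType.

Record lin_functor := LinFunctor {
  fobj :> nat -> lmodType k;
  fmap : forall n m, Hom k n m -> fobj n -> fobj m;
  fmap_linear : forall n m (u : Hom k n m), linear (fmap u);
  fmap_comb : forall n m c (u v : Hom k n m) x,
    fmap (c *: u + v) x = c *: fmap u x + fmap v x;
  fmap_id : forall n x, fmap (hom_id k n) x = x;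
  fmap_comp : forall n m p (u : Hom k n m) (v : Hom k m p) x,
    fmap (hom_comp u v) x = fmap v (fmap u x)
}.
Arguments fmap _ {n m} _ _.
Arguments fmap_linear _ {n m} _.

HB.instance Definition _ (F : lin_functor) n m (u : Hom k n m) :=
  GRing.isLinear.Build k (F n) (F m) *:%R (fmap F u) (fmap_linear F u).

Definition representable (n : nat) : lin_functor :=
  @LinFunctor (Hom k n) (fun m p u x => hom_comp x u)
    (fun m p u c x y => hom_compPl c x y u)
    (fun m p c u v x => hom_compPr x c u v)
    (fun m x => hom_compx1 x)
    (fun m p q u v x => esym (hom_compA x u v)).

(* The sum of [(-1)^j d_{i,j}] over [i < j], [i] ranging over ['I_j]. In degree
   [0] the differential is taken to be the zero map from [T 0] to itself. *)
Definition leib_elt (m : nat) : Hom k m m.-1 :=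
  match m return Hom k m m.-1 with
  | 0 => 0
  | m'.+1 => \sum_(j < m'.+2) \sum_(i < j) (-1) ^+ j *: dmor i k
  end.

Section Homology.
Variables (F : lin_functor) (m : nat).

Definition leib_diff (r : nat) : F r -> F r.-1 := fmap F (leib_elt r).

Definition leib_cycles : {pred F m} := fun x => leib_diff x == 0.

Fact leib_cycles_closed : submod_closed leib_cycles.
Proof.
split=> [|c x y /eqP dx /eqP dy]; apply/eqP; rewrite /leib_diff.
  exact: raddf0.
rewrite /leib_diff in dx dy; rewrite linearP /= dx dy.
by rewrite scaler0 addr0.
Qed.
HB.instance Definition _ :=
  GRing.isSubmodClosed.Build k (F m) leib_cycles leib_cycles_closed.

Record leib_cycle := LeibCycle {
  cycle_val :> F m; _ : cycle_val \in leib_cycles }.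
HB.instance Definition _ := [isSub for cycle_val].
HB.instance Definition _ := [Choice of leib_cycle by <:].
HB.instance Definition _ := [SubChoice_isSubLmodule of leib_cycle by <:].

(* The functor sends [leib_elt m] to the differential, so this is its kernel in
   degree [m] modulo the image of the differential from degree [m + 1]. *)
Definition leib_homology : lmodType k :=
  quot_mod (fun z : leib_cycle => exists y : F m.+1, leib_diff y = z).
End Homology.
End Leibniz.

(* Main.v *)
From mathcomp Require Import all_boot all_algebra zify.
Require Import Defs.

Set Implicit Arguments.
Unset Strict Implicit.
Unset Printing Implicit Defensive.

Import GRing.Theory.
Local Open Scope ring_scope.

(* Induction on [n]; write [x_top] for the variable [x_{n+1}] of [P_{n+1}].
   Precomposition with [d_{c, n+1}], that is, the substitution of [[x_c, x_top]]
   for [x_c], is a chain map [s_c : P_n -> P_{n+1}] for every [c <= n]. Adjoining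
   the singleton block [x_top] is a linear map [e : P_n -> P_{n+1}] of degree [1].
   As [ad x_top] is a derivation, every [z] in [P_{n+1}] is of the form
   [e u + sum_c s_c v_c], and [d (e u) = e (d u) +- sum_c s_c u]. The [v_c] can be
   read off: letting [x_top] act as the derivation that fixes [x_c] and kills the
   other variables defines [r_c : P_{n+1} -> P_n] with [r_c s_c = 1], [r_c s_c' = 0]
   for [c' <> c], and [r_c e = 0]. If [d z = 0], applying [r_c] gives
   [d v_c = -+ u] for all [c]; up to the boundary of [+- e v_0], [z] is then
   [sum_c s_c (v_c - v_0)], where the [v_c - v_0] are cycles, hence boundaries by
   induction. *)

(** * Multiplicities of leaves, and grafting of trees *)

Lemma is_monP (T : finType) (A : {set T}) t :
  is_mon A t <-> forall x, count_mem x (leaves t) = (x \in A).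
Proof.
split=> [/andP[ut /eqP<-] x|ct]; first by rewrite inE count_uniq_mem.
have tA x : (x \in leaves t) = (x \in A).
  by rewrite -has_pred1 has_count ct; case: (x \in A).
apply/andP; split; last by apply/eqP/setP=> x; rewrite inE tA.
by apply: count_mem_uniq => x; rewrite ct tA.
Qed.

Section Graft.
Variables (J T : finType).
Implicit Types (g : J -> tree T) (t : tree J).

Fixpoint tbind g t := match t with
  | Leaf j => g j
  | Node s u => Node (tbind g s) (tbind g u)
  end.

Lemma count_leaves_tbind g t a :
  count a (leaves (tbind g t)) = (\sum_(j <- leaves t) count a (leaves (g j)))%N.
Proof.
elim: t => [j|s IHs u IHu] /=; first by rewrite big_seq1.
by rewrite count_cat IHs IHu big_cat.
Qed.

Lemma eq_tbind g g' t : {in leaves t, g =1 g'} -> tbind g t = tbind g' t.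
Proof.
elim: t => [j|s IHs u IHu] /= gg'; first by rewrite gg' ?mem_head.
by rewrite IHs ?IHu // => j jt; rewrite gg' // mem_cat jt ?orbT.
Qed.

(** [lie_eval] takes as intermediate targets the sets [fam_cover], which are exactly the leaf sets
    of the grafted subtrees, so [lbr_mon] applies at every node. *)
Lemma lie_eval_mon (k : comPzRingType) (A : J -> {set T}) (f : forall j, Lie k (A j))
    g (D : {set T}) t :
  (forall j, is_mon (A j) (g j)) -> (forall j, f j = lie_mon k (A j) (g j)) ->
  lie_eval f D t = lie_mon k D (tbind g t).
Proof.
move=> gA fE.
have lsetE s : lset (tbind g s) = fam_cover A (lset s).
  elim: s => [j|s IHs u IHu] /=; last by rewrite !lset_node fam_coverU IHs IHu.
  by rewrite fam_cover1 (lset_mon (gA j)).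
elim: t D => [j|s IHs u IHu] D /=; last by rewrite IHs IHu lbr_mon.
by rewrite fE /recast lie_lift_mon //; apply: recast_compat.
Qed.
End Graft.

Lemma tbind_tbind (I J T : finType) (g : J -> tree T) (h : I -> tree J) t :
  tbind g (tbind h t) = tbind (fun i => tbind g (h i)) t.
Proof. by elim: t => //= s -> u ->. Qed.

Lemma tbind_leaf (T : finType) (t : tree T) : tbind (fun x => Leaf x) t = t.
Proof. by elim: t => //= s -> u ->. Qed.

(** * Tensors of Lie monomials *)

Section HomLift.
Variables (k : comPzRingType) (n m : nat) (V : lmodType k).
Variable phi : forall a : shuf n m, tens_gen (fun i => Lie k (fiber a i)) -> V.
Hypothesis phiM : forall a, multilinear (phi (a := a)).

Definition hom_lift (x : Hom k n m) : V := \sum_a tens_lift (phi (a := a)) (x a).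

Lemma hom_lift_linear : linear hom_lift.
Proof.
move=> c x y; rewrite scaler_sumr -big_split; apply: eq_bigr => a _ /=.
by rewrite dsumP (tens_lift_linear (@phiM a)).
Qed.

Lemma hom_lift_pure (a : shuf n m) f : hom_lift (pure (a := a) f) = phi f.
Proof.
rewrite /hom_lift (bigD1 a) //= dinj_in (tens_lift_pure (@phiM a)).
rewrite big1 ?addr0 // => b ba; rewrite dinj_out 1?eq_sym //.
exact: lin0 (tens_lift_linear (@phiM b)).
Qed.
End HomLift.

Lemma pure_eq0 (k : comPzRingType) n m (a : shuf n m)
    (f : tens_gen (fun i => Lie k (fiber a i))) i : f i = 0 -> pure f = 0.
Proof.
(* Multilinearity with both summands equal to [f]: as [f i = - f i + f i], the tensor equals its
   opposite plus itself. *)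
move=> fi; rewrite (@pure_comb _ _ _ _ f f f i (-1)) //.
  by rewrite scaleN1r addNr.
by rewrite fi scaler0 addr0.
Qed.

Section HomComp.
Variables (k : comPzRingType) (n m p : nat).

Lemma hom_comp_linl (y : Hom k m p) : linear (fun x : Hom k n m => hom_comp x y).
Proof. by move=> c x x'; rewrite hom_compPl. Qed.

Lemma hom_comp_linr (x : Hom k n m) : linear (fun y : Hom k m p => hom_comp x y).
Proof. by move=> c y y'; rewrite hom_compPr. Qed.
End HomComp.

Section Mono.
Variables (k : comPzRingType).

(* Only meaningful when [t i] is a monomial in the variables of the fibre of [i]. *)
Definition hom_mon n m (a : shuf n m) (t : 'I_m.+1 -> tree 'I_n.+1) : Hom k n m :=
  pure (a := a) [ffun i => lie_mon k (fiber a i) (t i)].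

Lemma eq_hom_mon n m (a b : shuf n m) s t : a =1 b -> s =1 t -> hom_mon a s = hom_mon b t.
Proof.
move=> ab st; have <- : a = b by apply/val_inj/ffunP.
by congr pure; apply/ffunP=> i; rewrite !ffunE st.
Qed.

Lemma hom_comp_mon n m p (a : shuf n m) (b : shuf m p) s t :
  (forall i, is_mon (fiber a i) (s i)) -> (forall i, is_mon (fiber b i) (t i)) ->
  hom_comp (hom_mon a s) (hom_mon b t) = hom_mon (shuf_comp a b) (fun i => tbind s (t i)).
Proof.
move=> sa tb; rewrite hom_comp_pure; congr pure; apply/ffunP=> i; rewrite !ffunE.
by rewrite lsubst_mon // (lie_eval_mon (g := s)) // => j; rewrite ffunE.
Qed.

Section Slot.
Variables (n m : nat) (a : shuf n m) (t : 'I_m.+1 -> tree 'I_n.+1) (p : 'I_m.+1).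

(** Linear in the factor at [p], the others being fixed monomials: an identity in the [Lie] module
    of one block becomes an identity of morphisms. *)
Definition mon_slot (x : Lie k (fiber a p)) : Hom k n m :=
  pure (tens_upd [ffun i => lie_mon k (fiber a i) (t i)] x).

Lemma mon_slot_linear : linear mon_slot.
Proof. by move=> c x y; rewrite /mon_slot /pure tpure_multilinear dinj_linear. Qed.

Lemma mon_slot_mon u :
  mon_slot (lie_mon k _ u) = hom_mon a (fun i => if i == p then u else t i).
Proof.
congr pure; apply/ffunP=> i; rewrite !ffunE; have [->|ip] := eqVneq i p.
  by rewrite dfwith_in.
by rewrite dfwith_out 1?eq_sym // ffunE.
Qed.
End Slot.

Lemma hom_mon_ind n m (P : Hom k n m -> Prop) : P 0 ->
  (forall c x y, P x -> P y -> P (c *: x + y)) ->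
  (forall (a : shuf n m) t, (forall i, is_mon (fiber a i) (t i)) -> P (hom_mon a t)) ->
  forall x, P x.
Proof.
move=> P0 PD Pm x.
have PD' y z : P y -> P z -> P (y + z) by rewrite -{2}[y]scale1r; apply: PD.
rewrite [x]dsum_sum; apply: (big_ind P) => // a _.
elim/pres_ind: (x a) => [|c u v Hu Hv|f].
- by rewrite (lin0 (@dinj_linear _ _ _ a)).
- by rewrite dinj_linear; apply: PD.
rewrite -/(tpure f) -/(pure f).
(* Multilinear expansion one factor at a time: [r] lists the places not yet known to hold a
   monomial. *)
suff H r : uniq r -> forall f : tens_gen (fun i => Lie k (fiber a i)),
    (forall i, i \notin r -> exists2 t, is_mon (fiber a i) t & f i = lie_mon k _ t) ->
    P (pure f).
  by apply: (H (index_enum _)) => [|i]; rewrite ?index_enum_uniq ?mem_index_enum.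
elim: r => [_|p r IH /= /andP[pr ur]] {}f fr.
  have [t [ta ft]] : exists t : 'I_m.+1 -> tree 'I_n.+1,
      (forall i, is_mon (fiber a i) (t i)) /\ forall i, f i = lie_mon k _ (t i).
    have /fin_all_exists[t tE] i : exists t, is_mon (fiber a i) t /\ f i = lie_mon k _ t.
      by have [//|t ta ft] := fr i; exists t.
    by exists t; split=> i; case: (tE i).
  suff -> : pure f = hom_mon a t by apply: Pm.
  by congr pure; apply/ffunP=> i; rewrite ffunE.
have slot_lin : linear (fun x : Lie k (fiber a p) => pure (tens_upd f x)).
  by move=> c u v; rewrite /pure tpure_multilinear dinj_linear.
have -> : f = tens_upd f (f p).
  apply/ffunP=> i; rewrite ffunE; have [<-|ip] := eqVneq p i.
    by rewrite dfwith_in.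
  by rewrite dfwith_out.
elim/lie_ind: (f p) => [|c u v Hu Hv|t tp]; first by rewrite (lin0 slot_lin).
  by rewrite slot_lin; apply: PD.
apply: IH => // i ir; have [ip|ip] := eqVneq p i.
  by subst i; exists t => //; rewrite ffunE dfwith_in.
have [|u ua fu] := fr i; first by rewrite inE eq_sym (negPf ip).
by exists u => //; rewrite ffunE dfwith_out.
Qed.

Lemma hom_mon_ext n m (V : lmodType k) (F G : Hom k n m -> V) :
  linear F -> linear G ->
  (forall (a : shuf n m) t, (forall i, is_mon (fiber a i) (t i)) ->
     F (hom_mon a t) = G (hom_mon a t)) -> F =1 G.
Proof.
move=> lF lG FG; apply: hom_mon_ind => //; first by rewrite !lin0.
by move=> c x y Fx Fy; rewrite lF lG Fx Fy.
Qed.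
End Mono.

(** Shuffling surjections are restricted growth functions: before a value appears, all smaller ones
    have appeared. This form avoids minima of fibres and is easy to check when the last point is
    added or removed. *)
Lemma shuffling_growth n m (a : {ffun 'I_n.+1 -> 'I_m.+1}) :
  reflect ((forall i, exists x, a x = i) /\
    forall x (i : 'I_m.+1), (i < a x)%N -> exists2 y : 'I_n.+1, (y < x)%N & a y = i)
  (shuffling a).
Proof.
apply: (iffP (shufflingP a)) => [[a0 sa ma]|[sa ga]]; split=> //.
- move=> x i ix; have [z az] := sa i; have [y] := fiber_minP a z.
  rewrite az => ay my; exists y => //; rewrite -my.
  exact: leq_trans (ma _ _ ix) (fiber_min_le a x).
- case: (posnP (a ord0)) => [a0|]; first exact: val_inj.
  by case/(@ga ord0 ord0).
move=> i j ij; have [z az] := sa j; have [y] := fiber_minP a z.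
rewrite az => ay ->; have [|x xy <-] := ga y i; first by rewrite ay.
exact: leq_ltn_trans (fiber_min_le a x) xy.
Qed.

(** * Substituting [[x_c, x_top]] for [x_c] *)

Section Top.
Variable n : nat.
Local Notation top := (ord_max : 'I_n.+2).
Local Notation up := (lift top).

Lemma up_neq_top (x : 'I_n.+1) : (up x == top) = false.
Proof. by apply/negbTE; rewrite eq_sym neq_lift. Qed.

(** [c] serves as an index below [ord_max] because the value of [ord_max] computes to [n.+1]. *)
Definition merge_top (c : 'I_n.+1) : shuf n.+1 n := @merge_shuf n ord_max c.
Definition merge_top_tree (c : 'I_n.+1) : 'I_n.+1 -> tree 'I_n.+2 :=
  @merge_tree n ord_max c.

Lemma merge_top_up c x : merge_top c (up x) = x.
Proof. exact: merge_lift. Qed.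

Lemma merge_top_top c : merge_top c top = c.
Proof. by apply/val_inj; rewrite /= merge_funE eqxx. Qed.

Lemma merge_top_tree_mon c p : is_mon (fiber (merge_top c) p) (merge_top_tree c p).
Proof. exact: merge_tree_mon. Qed.

Lemma merge_top_treeE c p : merge_top_tree c p =
  if p == c then Node (Leaf (up p)) (Leaf top) else Leaf (up p).
Proof. by []. Qed.

Definition up_tree := tbind (fun x : 'I_n.+1 => Leaf (up x)).
(** A leaf [top] would be renamed to the default [ord0]; [down_treeK] therefore assumes that [top]
    is absent. *)
Definition down_tree :=
  tbind (fun x : 'I_n.+2 => Leaf (odflt ord0 (unlift top x))).

Lemma down_treeK t : top \notin leaves t -> up_tree (down_tree t) = t.
Proof.
move=> tt; rewrite /down_tree /up_tree tbind_tbind -[RHS]tbind_leaf.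
apply: eq_tbind => x xt /=.
by case: unliftP => [y ->//|xE]; rewrite xE in xt; rewrite xt in tt.
Qed.

Lemma count_up_up x t : count_mem (up x) (leaves (up_tree t)) = count_mem x (leaves t).
Proof.
rewrite count_leaves_tbind -sum1_count [RHS]big_mkcond; apply: eq_bigr => y _ /=.
by rewrite (inj_eq lift_inj) addn0 eq_sym; case: eqP.
Qed.

Lemma count_top_up t : count_mem top (leaves (up_tree t)) = 0%N.
Proof. by rewrite count_leaves_tbind big1 // => y _ /=; rewrite up_neq_top. Qed.

Lemma count_up_merge_top c x t :
  count_mem (up x) (leaves (tbind (merge_top_tree c) t)) = count_mem x (leaves t).
Proof.
rewrite count_leaves_tbind -sum1_count [RHS]big_mkcond; apply: eq_bigr => y _.
rewrite merge_top_treeE; case: ifP => _ /=; rewrite (inj_eq lift_inj) ?addn0.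
  by rewrite [top == _]eq_sym up_neq_top addn0; case: eqP.
by case: eqP.
Qed.

Lemma count_top_merge_top c t :
  count_mem top (leaves (tbind (merge_top_tree c) t)) = count_mem c (leaves t).
Proof.
rewrite count_leaves_tbind -sum1_count [RHS]big_mkcond; apply: eq_bigr => y _.
by rewrite merge_top_treeE /=; case: ifP => _ /=; rewrite up_neq_top ?eqxx.
Qed.

Lemma tbind_merge_top_out c t : c \notin leaves t -> tbind (merge_top_tree c) t = up_tree t.
Proof.
move=> ct; apply: eq_tbind => x xt; rewrite merge_top_treeE; case: eqP => // xc.
by rewrite -xc xt in ct.
Qed.

Lemma lset_merge_top c t : c \in leaves t ->
  lset (tbind (merge_top_tree c) t) = lset (Node (up_tree t) (Leaf top)).
Proof.
move=> ct; apply/setP=> x; rewrite !inE /= mem_cat -!has_pred1 !has_count.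
case: (unliftP top x) => [y ->|->].
  by rewrite count_up_merge_top count_up_up /= [top == _]eq_sym up_neq_top orbF.
by rewrite count_top_merge_top count_top_up /= eqxx -has_count has_pred1 ct.
Qed.

(* This is the fact that [ad x_top] is a derivation. *)
Lemma lie_mon_top (k : comPzRingType) D t : uniq (leaves t) ->
  lie_mon k D (Node (up_tree t) (Leaf top)) =
  \sum_(c <- leaves t) lie_mon k D (tbind (merge_top_tree c) t).
Proof.
elim: t D => [x|s IHs u IHu] D /=.
  by move=> _; rewrite big_seq1 merge_top_treeE eqxx.
rewrite cat_uniq => /and3P[us /hasPn su uu]; rewrite big_cat /=.
have -> : lie_mon k D (Node (Node (up_tree s) (up_tree u)) (Leaf top)) =
    lie_mon k D (Node (Node (up_tree s) (Leaf top)) (up_tree u))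
    + lie_mon k D (Node (up_tree s) (Node (up_tree u) (Leaf top))).
  have /= := lie_mon_jacobi k D Hole (up_tree s) (up_tree u) (Leaf top).
  by move=> ->; rewrite addrC subrK.
(* By induction the first term is the sum over the leaves [c] of [s]. Such a [c] is not a leaf of
   [u], so the substitution for [x_c] only renames [u]. The second term is symmetric. *)
congr (_ + _).
  rewrite -(lbr_mon _ _ (erefl (lset (Node (up_tree s) (Leaf top)))) (erefl _)).
  rewrite IHs // (lin_sum (lbr_linearl _ _)) !big_seq; apply: eq_bigr => c cs.
  rewrite lbr_mon ?[in RHS](tbind_merge_top_out (t := u)) ?lset_merge_top //.
  by apply: contraL cs; apply: su.
rewrite -(lbr_mon _ _ (erefl _) (erefl (lset (Node (up_tree u) (Leaf top))))).
rewrite IHu // (lin_sum (lbr_linearr _ _)) !big_seq; apply: eq_bigr => c cu.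
by rewrite lbr_mon ?[in RHS](tbind_merge_top_out (t := s)) ?lset_merge_top //; apply: su.
Qed.

End Top.

(** * Adjoining a singleton block *)

Lemma shuf_compE n m p (a : shuf n m) (b : shuf m p) x : shuf_comp a b x = b (a x).
Proof. by rewrite ffunE. Qed.

Lemma is_mon_comp n m p (a : shuf n m) (b : shuf m p) s t i :
  (forall j, is_mon (fiber a j) (s j)) -> is_mon (fiber b i) t ->
  is_mon (fiber (shuf_comp a b) i) (tbind s t).
Proof.
move=> sa /is_monP tb; apply/is_monP=> x.
rewrite count_leaves_tbind inE shuf_compE.
rewrite (eq_bigr (fun j => (x \in fiber a j) : nat)) => [|j _]; last first.
  by have /is_monP-> := sa j.
have -> : (\sum_(j <- leaves t) (x \in fiber a j) = count_mem (a x) (leaves t))%N.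
  rewrite -sum1_count [RHS]big_mkcond; apply: eq_bigr => j _.
  by rewrite inE /= eq_sym; case: eqP.
by rewrite tb inE.
Qed.

Section Ext.
Variables (n m : nat) (a : shuf n m).

Definition ext_fun : {ffun 'I_n.+2 -> 'I_m.+2} :=
  [ffun x => if unlift ord_max x is Some y then lift ord_max (a y) else ord_max].

Lemma ext_fun_up x : ext_fun (lift ord_max x) = lift ord_max (a x).
Proof. by rewrite ffunE liftK. Qed.

Lemma ext_fun_top : ext_fun ord_max = ord_max.
Proof. by rewrite ffunE unlift_none. Qed.

Fact ext_proof : shuffling ext_fun.
Proof.
have /shuffling_growth[sa ga] := valP a; rewrite /= in sa ga.
apply/shuffling_growth; split=> [i|x i].
  case: (unliftP ord_max i) => [j ->|->].
    by have [x <-] := sa j; exists (lift ord_max x); rewrite ext_fun_up.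
  by exists ord_max; rewrite ext_fun_top.
case: (unliftP ord_max i) => [j ->|->]; last first.
  by rewrite ltnNge -ltnS ltn_ord.
case: (unliftP ord_max x) => [y ->|->].
  rewrite ext_fun_up !lift_max => /ga[z zy <-].
  by exists (lift ord_max z); rewrite ?ext_fun_up ?lift_max.
(* The last point takes the new last value, and every smaller value is already taken at an earlier
   point since [a] is surjective. *)
move=> _; have [y <-] := sa j.
by exists (lift ord_max y); rewrite ?ext_fun_up // lift_max.
Qed.

Definition ext : shuf n.+1 m.+1 := Shuf ext_proof.

Lemma ext_up x : ext (lift ord_max x) = lift ord_max (a x).
Proof. exact: ext_fun_up. Qed.

Lemma ext_top : ext ord_max = ord_max.
Proof. exact: ext_fun_top. Qed.

Definition ext_tree (t : 'I_m.+1 -> tree 'I_n.+1) (i : 'I_m.+2) : tree 'I_n.+2 :=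
  if unlift ord_max i is Some j then up_tree (t j) else Leaf ord_max.

Lemma ext_tree_mon t : (forall i, is_mon (fiber a i) (t i)) ->
  forall i, is_mon (fiber ext i) (ext_tree t i).
Proof.
move=> ta i; apply/is_monP=> x; rewrite /ext_tree inE.
case: (unliftP ord_max i) => [j ->|->]; case: (unliftP ord_max x) => [y ->|->].
- rewrite count_up_up ext_up (inj_eq lift_inj).
  by have /is_monP-> := ta j; rewrite inE.
- by rewrite count_top_up ext_top [_ == lift _ _]eq_sym up_neq_top.
- by rewrite /= ext_up [_ == lift _ _]eq_sym !up_neq_top.
by rewrite /= ext_top !eqxx.
Qed.
End Ext.

Lemma ext_comp n m p (a : shuf n m) (b : shuf m p) :
  shuf_comp (ext a) (ext b) =1 ext (shuf_comp a b).
Proof.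
move=> x; case: (unliftP ord_max x) => [y ->|->].
  by rewrite shuf_compE !ext_up shuf_compE.
by rewrite shuf_compE !ext_top.
Qed.

Lemma ext_tree_comp n m p (s : 'I_m.+1 -> tree 'I_n.+1) (t : 'I_p.+1 -> tree 'I_m.+1) i :
  tbind (ext_tree s) (ext_tree t i) = ext_tree (fun j => tbind s (t j)) i.
Proof.
rewrite {2 3}/ext_tree; case: (unliftP ord_max i) => [j _|_] /=; last first.
  by rewrite /ext_tree unlift_none.
rewrite /up_tree !tbind_tbind; apply: eq_tbind => l _ /=.
by rewrite /ext_tree liftK.
Qed.

(* The morphisms [d_{c, n+1}]; precomposing with them embeds copies of [P_n] in [P_{n+1}]. *)
Local Notation dtop k c := (hom_mon k (merge_top c) (merge_top_tree c)).

Section Adjoin.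
Variable k : comPzRingType.

(** The renaming of variables along [lift ord_max] is expressed as an operadic substitution of
    generators, so that its linearity comes from [lsubst]. *)
Definition adjoin_pure n m (a : shuf n m) (f : tens_gen (fun i => Lie k (fiber a i))) :
    Hom k n.+1 m.+1 :=
  pure (a := ext a) [ffun i => if unlift ord_max i is Some j
    then lsubst (fun x : 'I_n.+1 => lie_mon k [set lift ord_max x] (Leaf (lift ord_max x)))
           (fiber (ext a) i) (f j)
    else lie_mon k (fiber (ext a) i) (Leaf ord_max)].

Lemma adjoin_pure_multilinear n m (a : shuf n m) : multilinear (adjoin_pure (a := a)).
Proof.
move=> f i c x y; apply: (pure_comb (i := lift ord_max i)) => [|j ji|j ji].
- by rewrite !ffunE liftK !ffunE !dfwith_in lsubst_comb.
- rewrite !ffunE; case: unliftP => // l jl; rewrite !ffunE !dfwith_out //;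
    by rewrite jl (inj_eq lift_inj) eq_sym in ji.
- rewrite !ffunE; case: unliftP => // l jl; rewrite !ffunE !dfwith_out //;
    by rewrite jl (inj_eq lift_inj) eq_sym in ji.
Qed.

(* [f_0 (x) ... (x) f_m |-> f_0 (x) ... (x) f_m (x) x_{n+1}] *)
Definition adjoin n m : Hom k n m -> Hom k n.+1 m.+1 := hom_lift (@adjoin_pure n m).

Lemma adjoin_linear n m : linear (@adjoin n m).
Proof. exact: hom_lift_linear (@adjoin_pure_multilinear n m). Qed.

Lemma adjoin_mon n m (a : shuf n m) t : (forall i, is_mon (fiber a i) (t i)) ->
  adjoin (hom_mon k a t) = hom_mon k (ext a) (ext_tree t).
Proof.
move=> ta; rewrite /adjoin (hom_lift_pure (@adjoin_pure_multilinear n m)).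
congr pure; apply/ffunP=> i; rewrite !ffunE /ext_tree; case: unliftP => // j _.
rewrite ffunE lsubst_mon // (lie_eval_mon (g := fun x => Leaf (lift ord_max x))) //.
by move=> x; apply/is_monP=> y; rewrite inE /= addn0 eq_sym.
Qed.

Lemma adjoin_comp n m p (u : Hom k n m) (v : Hom k m p) :
  hom_comp (adjoin u) (adjoin v) = adjoin (hom_comp u v).
Proof.
move: u; apply: hom_mon_ext => [c x y|c x y|a s sa].
- by rewrite adjoin_linear hom_compPl.
- by rewrite hom_compPl adjoin_linear.
move: v; apply: hom_mon_ext => [c x y|c x y|b t tb].
- by rewrite adjoin_linear hom_compPr.
- by rewrite hom_compPr adjoin_linear.
rewrite !adjoin_mon // !hom_comp_mon //; try exact: ext_tree_mon.
rewrite adjoin_mon; first by apply: eq_hom_mon => [x|i]; rewrite ?ext_comp ?ext_tree_comp.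
by move=> i; apply: is_mon_comp.
Qed.

Lemma adjoin_dmor n (j : 'I_n.+2) (i : 'I_j) :
  adjoin (dmor i k) = @dmor n.+1 (widen_ord (leqnSn _) j) i k.
Proof.
rewrite -[LHS]/(adjoin (hom_mon k (merge_shuf i) (merge_tree i))).
rewrite adjoin_mon; last exact: merge_tree_mon.
have ij := ltn_ord i; have jn := ltn_ord j.
apply: eq_hom_mon => [x|p].
  apply/val_inj; rewrite /= [RHS]merge_funE -val_eqE /=.
  case: (unliftP ord_max x) => [y ->|->].
    by rewrite ext_up !lift_max /= merge_funE.
  by rewrite ext_top /=; repeat case: ifP; lia.
rewrite /ext_tree /merge_tree; case: (unliftP ord_max p) => [q ->|->].
  rewrite !lift_max; case: ifP => _ /=; repeat congr Node; congr Leaf;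
    apply/val_inj; rewrite /= /bump /=; have qn := ltn_ord q; lia.
case: ifP => [/= |_]; first lia.
by congr Leaf; apply/val_inj; rewrite /= /bump; lia.
Qed.

(** Separate from [leib_eltS]: [leib_elt k 0] is the zero endomorphism of [[0]], so adjoining a
    block to it would not give a morphism from [[1]] to [[0]]. *)
Lemma leib_elt1 : leib_elt k 1 = - \sum_(c < 1) dmor (c : 'I_(ord_max : 'I_2)) k.
Proof.
rewrite /leib_elt big_ord_recr /= [X in X + _]big1 => [|[[|//] ?] _]; last first.
  by rewrite big_ord0.
by rewrite add0r -scaler_sumr expr1 scaleN1r.
Qed.

(** The [d_{i,j}] with [j] below the top do not involve the last point, which they carry along as a
    singleton block; those with [j] the top all have the same sign. *)
Lemma leib_eltS m : leib_elt k m.+2 = adjoin (leib_elt k m.+1)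
  + (-1) ^+ m.+2 *: \sum_(c < m.+2) dmor (c : 'I_(ord_max : 'I_m.+3)) k.
Proof.
rewrite /leib_elt big_ord_recr /= scaler_sumr; congr (_ + _).
rewrite (lin_sum (@adjoin_linear _ _)); apply: eq_bigr => j _.
rewrite (lin_sum (@adjoin_linear _ _)); apply: eq_bigr => i _.
by rewrite (linZ (@adjoin_linear _ _)) adjoin_dmor.
Qed.

(** Merging the new block into block [i] brackets the factor [f_i] with [x_top]. By [lie_mon_top]
    this is the sum, over the variables [x_c] of that block, of the substitutions of [[x_c, x_top]]
    for [x_c]. *)
Lemma adjoin_sum_dmor n m (u : Hom k n m) :
  hom_comp (adjoin u) (\sum_(c < m.+1) dtop k c) =
  hom_comp (\sum_(c < n.+1) dtop k c) u.
Proof.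
move: u; apply: hom_mon_ext => [c x y|c x y|a t ta].
- by rewrite adjoin_linear hom_compPl.
- by rewrite hom_compPr.
rewrite adjoin_mon // (lin_sum (hom_comp_linr _)) (lin_sum (hom_comp_linl _)).
(* The variables [c] on the right are grouped by their block [i = a c]. *)
rewrite (partition_big a xpredT) //=; apply: eq_bigr => i _.
have tm := @merge_top_tree_mon; have te := ext_tree_mon ta.
rewrite hom_comp_mon //.
set b := shuf_comp _ _.
transitivity (mon_slot (a := b) (fun j => up_tree (t j))
    (lie_mon k (fiber b i) (Node (up_tree (t i)) (Leaf ord_max)))).
  rewrite mon_slot_mon; apply: eq_hom_mon => // j; rewrite merge_top_treeE.
  case: eqP => [->|_] /=; rewrite /ext_tree liftK //.
  by rewrite unlift_none.
have /andP[ui _] := ta i.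
rewrite lie_mon_top // (lin_sum (@mon_slot_linear _ _ _ _ _ _)).
rewrite big_uniq //=.
rewrite [LHS](eq_bigl (fun c => a c == i)) => [|c]; last first.
  by have /andP[_ /eqP/setP/(_ c)] := ta i; rewrite !inE.
apply: eq_bigr => c /eqP ac.
rewrite mon_slot_mon.
rewrite (hom_comp_mon k (@merge_top_tree_mon n c) ta).
apply: eq_hom_mon => [x|j].
  rewrite !shuf_compE; case: (unliftP ord_max x) => [y ->|->].
    by rewrite ext_up !merge_top_up.
  by rewrite ext_top !merge_top_top.
case: eqP => [->//|/eqP ji]; rewrite tbind_merge_top_out //.
apply: contra ji; have /andP[_ /eqP/setP/(_ c)] := ta j.
by rewrite !inE => ->; rewrite ac eq_sym.
Qed.
End Adjoin.

(** * Retractions by Euler derivations *)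

Section Euler.
Variables (k : comPzRingType) (J T : finType) (A : J -> {set T}).
Variables (f : forall j, Lie k (A j)) (e : J) (w : J -> k).
Hypotheses (Ae : A e = set0) (fe : f e = 0) (we : w e = 0).

Definition is_leaf (t : tree J) := if t is Leaf j then j == e else false.
Definition weight (t : tree J) : k := \sum_(j <- leaves t) w j.

(* The value of a monomial when [x_e] acts as the derivation multiplying [x_j] by
   [w j] and the other variables take the values [f j]: the bracket is that of the
   semidirect product of a Lie algebra with this derivation. *)
Fixpoint euler_eval D t : Lie k D := match t with
  | Leaf j => recast D (f j)
  | Node s u => ((is_leaf u)%:R * weight s) *: euler_eval D s
      - ((is_leaf s)%:R * weight u) *: euler_eval D u
      + lbr D (euler_eval (fam_cover A (lset s)) s) (euler_eval (fam_cover A (lset u)) u)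
  end.

Lemma euler_evalNL D s u : is_leaf s = false ->
  euler_eval D (Node s u) = ((is_leaf u)%:R * weight s) *: euler_eval D s
  + lbr D (euler_eval (fam_cover A (lset s)) s) (euler_eval (fam_cover A (lset u)) u).
Proof. by move=> /= ->; rewrite mul0r scale0r; congr (_ + _); apply: subr0. Qed.

Lemma euler_evalNR D s u : is_leaf u = false ->
  euler_eval D (Node s u) = - (((is_leaf s)%:R * weight u) *: euler_eval D u)
  + lbr D (euler_eval (fam_cover A (lset s)) s) (euler_eval (fam_cover A (lset u)) u).
Proof. by move=> /= ->; rewrite mul0r scale0r; congr (_ + _); apply: sub0r. Qed.

Lemma euler_evalN D s u : is_leaf s = false -> is_leaf u = false ->
  euler_eval D (Node s u) =
  lbr D (euler_eval (fam_cover A (lset s)) s) (euler_eval (fam_cover A (lset u)) u).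
Proof. by move=> ls lu; rewrite euler_evalNL // lu mul0r scale0r add0r. Qed.

Lemma is_leafE t : is_leaf t -> t = Leaf e.
Proof. by case: t => //= j /eqP->. Qed.

Lemma cover_leaf : fam_cover A (lset (Leaf e)) = set0.
Proof. by rewrite fam_cover1. Qed.

Lemma weight_leaf : weight (Leaf e) = 0.
Proof. by rewrite /weight big_seq1. Qed.

Lemma weight_node s u : weight (Node s u) = weight s + weight u.
Proof. by rewrite /weight big_cat. Qed.

Lemma weight_perm s t : perm_eq (leaves s) (leaves t) -> weight s = weight t.
Proof. exact: perm_big. Qed.

Lemma euler_eval_anti D s t : euler_eval D (Node s t) = - euler_eval D (Node t s).
Proof. by rewrite /= lbr_anti opprD opprB. Qed.

Lemma euler_evalNl D s :
  euler_eval D (Node (Leaf e) s) = - (weight s *: euler_eval D s).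
Proof.
have r0 E : recast E (f e) = 0 by rewrite fe (lin0 (@recast_linear _ _ _ _)).
rewrite /= eqxx mul1r !r0 lbr0x scaler0 addr0; exact: sub0r.
Qed.

Lemma euler_evalNr D s :
  euler_eval D (Node s (Leaf e)) = weight s *: euler_eval D s.
Proof. by rewrite euler_eval_anti euler_evalNl opprK. Qed.

(** Cases on which of [s], [t], [u] is [x_e]. If none is, this is the Jacobi identity of [lbr]. If
    exactly one is, it says that multiplication by the weight is a derivation, weights being
    additive. The other cases follow because [x_e] has value and weight zero. *)
Lemma euler_eval_jacobi D s t u : euler_eval D (Node s (Node t u)) =
  euler_eval D (Node (Node s t) u) - euler_eval D (Node (Node s u) t).
Proof.
have covN v v' : fam_cover A (lset (Node v v')) =
    fam_cover A (lset v) :|: fam_cover A (lset v').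
  by rewrite lset_node fam_coverU.
have zl := linZ (lbr_linearl _ _); have zr := linZ (lbr_linearr _ _).
have N v v' : is_leaf (Node v v') = false by [].
case: (boolP (is_leaf s)) => [/is_leafE->|/negbTE ls];
case: (boolP (is_leaf t)) => [/is_leafE->|/negbTE lt];
case: (boolP (is_leaf u)) => [/is_leafE->|/negbTE lu].
all: rewrite ?(euler_evalNl, euler_evalNr) //.
all: rewrite ?[euler_eval D (Node _ _)]euler_evalN ?N //.
all: rewrite ?(euler_evalNl, euler_evalNr) //.
all: rewrite ?covN ?cover_leaf ?set0U ?setU0 ?weight_node ?weight_leaf ?addr0 ?add0r.
all: rewrite ?scale0r ?oppr0 ?scaler0 ?lbr0x ?lbrx0 ?subrr ?oppr0 //.
- by rewrite addr0.
- by rewrite add0r.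
- by rewrite scalerN addr0.
- rewrite !lbrNl !zl [lbr D (euler_eval _ u) _]lbr_anti scalerN !opprK scalerDl.
  by rewrite opprD.
- by rewrite lbrNr zl zr scalerDl opprD addrA subrr add0r.
- by rewrite zl zr scalerDl addrAC subrr add0r.
by rewrite !euler_evalN //; apply: lbr_jacobi.
Qed.

Lemma is_leaf_plug c s t : is_leaf (plug c (Node s t)) = false.
Proof. by case: c. Qed.

(** At the root these are the two identities above. A context preserves them: the trees in a
    relation have the same leaves, hence the same weight and cover, and none of them is the bare
    leaf [x_e]. *)
Lemma euler_eval_compat B D : lie_compat B (euler_eval D).
Proof.
split=> [c s t _|c s t u _].
  have pe c' : perm_eq (leaves (plug c' (Node s t))) (leaves (plug c' (Node t s))).
    by apply: leaves_plug; rewrite /= perm_catC.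
  have e0 c' : lset (plug c' (Node s t)) = lset (plug c' (Node t s)).
    by apply/setP=> x; rewrite !inE (perm_mem (pe c')).
  elim: c D => [|c IH u|u c IH] D; first exact: euler_eval_anti.
    rewrite ![plug _ _]/= !euler_evalNL ?is_leaf_plug // IH IH lbrNl.
    by rewrite e0 (weight_perm (pe c)) scalerN opprD.
  rewrite ![plug _ _]/= !euler_evalNR ?is_leaf_plug // IH IH lbrNr.
  by rewrite e0 (weight_perm (pe c)) scalerN opprD.
have p1 c' : perm_eq (leaves (plug c' (Node s (Node t u))))
    (leaves (plug c' (Node (Node s t) u))).
  by apply: leaves_plug; rewrite /= catA.
have p2 c' : perm_eq (leaves (plug c' (Node s (Node t u))))
    (leaves (plug c' (Node (Node s u) t))).
  by apply: leaves_plug; rewrite /= -catA perm_cat2l perm_catC.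
have e1 c' : lset (plug c' (Node s (Node t u))) = lset (plug c' (Node (Node s t) u)).
  by apply/setP=> x; rewrite !inE (perm_mem (p1 c')).
have e2 c' : lset (plug c' (Node s (Node t u))) = lset (plug c' (Node (Node s u) t)).
  by apply/setP=> x; rewrite !inE (perm_mem (p2 c')).
elim: c D => [|c IH v|v c IH] D; first exact: euler_eval_jacobi.
- rewrite ![plug _ _]/= !euler_evalNL ?is_leaf_plug // IH IH lbrBl.
  rewrite -e1 -e2 -(weight_perm (p1 c)) -(weight_perm (p2 c)) scalerBr.
  by rewrite [in RHS]opprD addrACA.
- rewrite ![plug _ _]/= !euler_evalNR ?is_leaf_plug // IH IH lbrBr.
  rewrite -e1 -e2 -(weight_perm (p1 c)) -(weight_perm (p2 c)) scalerBr.
  by rewrite [in LHS]opprD [in RHS]opprD addrACA.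
Qed.
End Euler.


Section Retract.
Variables (k : comPzRingType) (n : nat) (c : 'I_n.+1).
Local Notation top := (ord_max : 'I_n.+2).

Definition below (j : 'I_n.+2) : {set 'I_n.+1} := [set x | lift top x == j].
(** For [j = top] the set is empty and the default leaf is no monomial on it, so the value is
    zero. *)
Definition below_gen j : Lie k (below j) :=
  lie_mon k (below j) (Leaf (odflt ord0 (unlift top j))).

(* [x_top] acts as the derivation that fixes [x_c] and kills the other variables. *)
Definition retract_eval := euler_eval below_gen top
  (fun j => (unlift top j == Some c)%:R).

Lemma below_top : below top = set0.
Proof. by apply/setP=> x; rewrite !inE up_neq_top. Qed.

Lemma below_up x : below (lift top x) = [set x].
Proof. by apply/setP=> y; rewrite !inE (inj_eq lift_inj). Qed.

Lemma below_gen_top : below_gen top = 0.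
Proof.
apply: lie_monN; apply/negP => /is_monP/(_ ord0).
by rewrite inE up_neq_top unlift_none.
Qed.

Lemma retract_compat B D : lie_compat B (retract_eval D).
Proof.
apply: euler_eval_compat; first exact: below_top.
  exact: below_gen_top.
by rewrite unlift_none.
Qed.

(** After the substitution [x_top] occurs only inside brackets [[x_c', x_top]], and the derivation
    sends such a bracket to [x_c'] times [1] or [0]. Each occurrence of [c'] in [t] contributes one
    such factor. *)
Lemma retract_eval_merge_top c' D t : retract_eval D (tbind (merge_top_tree c') t) =
  (\prod_(j <- leaves t) (if j == c' then (c' == c)%:R else 1)) *: lie_mon k D t.
Proof.
have leafE x E : recast E (below_gen (lift top x)) = lie_mon k E (Leaf x).
  rewrite /recast lie_lift_mon; first by rewrite liftK.
    exact: recast_compat.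
  by apply/is_monP=> y; rewrite liftK below_up inE /= addn0 eq_sym.
have topE E : recast E (below_gen top) = 0.
  by rewrite below_gen_top (lin0 (@recast_linear _ _ _ _)).
have nleaf t' : is_leaf top (tbind (merge_top_tree c') t') = false.
  by case: t' => //= x; rewrite merge_top_treeE; case: ifP => //= _; apply: up_neq_top.
have covE t' : fam_cover below (lset (tbind (merge_top_tree c') t')) = lset t'.
  apply/setP=> x; rewrite inE -has_pred1 has_count -(count_up_merge_top c') -has_count.
  rewrite has_pred1; apply/bigcupP/idP => [[j]|xt].
    by rewrite !inE => jt /eqP->.
  by exists (lift top x); rewrite ?inE.
elim: t D => [x|s IHs u IHu] D.
  rewrite big_seq1 /= merge_top_treeE; case: eqP => [->|_]; last first.
    by rewrite scale1r; apply: leafE.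
  rewrite /retract_eval euler_evalNr; last exact: below_gen_top.
  rewrite /weight big_seq1 liftK /= leafE; congr (_%:R *: _).
rewrite /retract_eval [tbind _ _]/= euler_evalN ?nleaf // -!/(retract_eval _ _).
rewrite !covE IHs IHu (linZ (lbr_linearl _ _)) (linZ (lbr_linearr _ _)) scalerA.
have e := lbr_mon k D (erefl (lset s)) (erefl (lset u)).
by rewrite [leaves (Node s u)]/= big_cat -e.
Qed.

(** The sum has at most one term, [b] being the restriction of [a] to the lower points. It is empty,
    giving zero, when [a] separates [x_c] from [x_top]. *)
Definition retract_pure m (a : shuf n.+1 m) (f : tens_gen (fun i => Lie k (fiber a i))) :
    Hom k n m :=
  \sum_(b | a == shuf_comp (merge_top c) b)
    pure (a := b) [ffun i => lie_lift (retract_eval (fiber b i)) (f i)].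

Lemma retract_pure_multilinear m (a : shuf n.+1 m) : multilinear (retract_pure (a := a)).
Proof.
move=> f i d x y; rewrite scaler_sumr -big_split; apply: eq_bigr => b _ /=.
apply: (pure_comb (i := i)) => [|j ji|j ji]; rewrite !ffunE ?dfwith_in.
- exact: (lie_lift_linear (retract_compat _ _)).
- by rewrite !dfwith_out // eq_sym.
- by rewrite !dfwith_out // eq_sym.
Qed.

Definition retract m : Hom k n.+1 m -> Hom k n m := hom_lift (@retract_pure m).

Lemma retract_linear m : linear (@retract m).
Proof. exact: hom_lift_linear (@retract_pure_multilinear m). Qed.

Lemma retract_adjoin m (u : Hom k n m) : retract (adjoin u) = 0.
Proof.
move: u; apply: (hom_mon_ext (G := fun=> 0)) => [d x y|d x y|a t ta].
- by rewrite adjoin_linear retract_linear.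
- by rewrite scaler0 addr0.
rewrite adjoin_mon // /retract (hom_lift_pure (@retract_pure_multilinear _)).
(* In [ext a] the point [top] is alone in its block, so [ext a] does not factor through
   [merge_top c]. *)
rewrite /retract_pure big_pred0 // => b; apply/negP=> /eqP e.
have := ext_top a; have := ext_up a c; rewrite e !shuf_compE merge_top_up merge_top_top => ->.
by move/eqP; rewrite up_neq_top.
Qed.

Lemma retract_merge_top m c' (u : Hom k n m) :
  retract (hom_comp (dtop k c') u) = (c' == c)%:R *: u.
Proof.
move: u; apply: (hom_mon_ext (G := fun u => (c' == c)%:R *: u)) => [d x y|d x y|b t tb].
- by rewrite hom_compPr retract_linear.
- by rewrite scalerDr !scalerA mulrC.
have tm := @merge_top_tree_mon.
rewrite hom_comp_mon // /retract (hom_lift_pure (@retract_pure_multilinear _)).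
rewrite /retract_pure.
have bE b' : shuf_comp (merge_top c') b == shuf_comp (merge_top c) b' -> b' = b.
  move/eqP=> e; apply/val_inj/ffunP=> x.
  by rewrite -[x in LHS](merge_top_up c) -shuf_compE -e shuf_compE merge_top_up.
have compE i : lie_lift (retract_eval (fiber b i))
    (lie_mon k (fiber (shuf_comp (merge_top c') b) i) (tbind (merge_top_tree c') (t i))) =
    (\prod_(j <- leaves (t i)) (if j == c' then (c' == c)%:R else 1))
      *: lie_mon k (fiber b i) (t i).
  rewrite lie_lift_mon ?retract_eval_merge_top //; first exact: retract_compat.
  exact: is_mon_comp.
have [cc|ncc] := eqVneq c' c; last first.
  (* The variable [x_c'] lies in block [b c'], whose factor is thus multiplied by [0], and the whole
     tensor vanishes. *)
  rewrite scale0r big1 // => b' /bE->; apply: (@pure_eq0 _ _ _ _ _ (b c')).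
  rewrite !ffunE compE (big_rem c') /=; last first.
    by have /andP[_ /eqP/setP/(_ c')] := tb (b c'); rewrite !inE eqxx.
  by rewrite eqxx (negPf ncc) mul0r scale0r.
rewrite (big_pred1 b) => [|b']; last first.
  by apply/idP/eqP => [/bE|->] //; rewrite cc.
rewrite scale1r; congr pure; apply/ffunP=> i; rewrite !ffunE compE cc eqxx.
by rewrite big1 ?scale1r // => j _; case: ifP.
Qed.
End Retract.

(** * Decomposition of [P_(n+1)] and exactness *)

Lemma spanned_lin_ind (k : pzRingType) (U V : lmodType k) (S : U -> Prop)
    (F : U -> V) (Q : V -> Prop) : linear F -> Q 0 ->
  (forall c x y, Q x -> Q y -> Q (c *: x + y)) -> (forall x, S x -> Q (F x)) ->
  forall x, spanned S x -> Q (F x).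
Proof.
move=> lF Q0 QD QS x; elim=> [|c u v Su _ IH]; first by rewrite (lin0 lF).
by rewrite lF; apply: QD => //; apply: QS.
Qed.

Lemma size_leaves (T : Type) (t : tree T) : (0 < size (leaves t))%N.
Proof. by elim: t => //= s IHs u _; rewrite size_cat addn_gt0 IHs. Qed.

Section TopSpan.
Variables (k : comPzRingType) (n : nat).
Local Notation top := (ord_max : 'I_n.+2).

(** The leaves are compared with those of [t] so that the set of variables is known when [x] is
    bracketed with another monomial. *)
Definition top_merged D (t : tree 'I_n.+2) (x : Lie k D) := exists c t',
  [/\ perm_eq (leaves (tbind (merge_top_tree c) t')) (leaves t), c \in leaves t'
    & x = lie_mon k D (tbind (merge_top_tree c) t')].

Lemma perm_merge_top c (t : tree 'I_n.+1) : uniq (leaves t) -> c \in leaves t ->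
  perm_eq (leaves (tbind (merge_top_tree c) t)) (leaves (Node (Leaf top) (up_tree t))).
Proof.
move=> ut ct; apply/allP=> x _; apply/eqP; rewrite /=.
case: (unliftP top x) => [y ->|->].
  by rewrite count_up_merge_top count_up_up [top == _]eq_sym up_neq_top.
by rewrite count_top_merge_top count_top_up eqxx count_uniq_mem ?ct.
Qed.

Lemma top_merged_perm D t t' (x : Lie k D) :
  perm_eq (leaves t) (leaves t') -> top_merged t x -> top_merged t' x.
Proof.
by move=> tt' [c [u [pu cu ->]]]; exists c, u; split=> //; apply: perm_trans tt'.
Qed.

(** By antisymmetry [x_top] may be put in the left subtree. If that subtree is [x_top] itself,
    [lie_mon_top] expands the bracket; otherwise induction expands the subtree and the right one is
    carried along. *)
Lemma top_span D (t : tree 'I_n.+2) : uniq (leaves t) -> top \in leaves t ->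
  t != Leaf top -> spanned (top_merged (D := D) t) (lie_mon k D t).
Proof.
have spanN E u (x : Lie k E) : spanned (top_merged (D := E) u) x ->
    spanned (top_merged (D := E) u) (- x).
  by rewrite -scaleN1r; apply: spannedZ.
elim: t D => [x|s IHs u IHu] D.
  by rewrite inE => _ /eqP->; rewrite eqxx.
move=> + + _.
have main s' u' : (forall D, uniq (leaves s') -> top \in leaves s' ->
      s' != Leaf top -> spanned (top_merged (D := D) s') (lie_mon k D s')) ->
    uniq (leaves s' ++ leaves u') -> top \in leaves s' ->
    spanned (top_merged (D := D) (Node s' u')) (lie_mon k D (Node s' u')).
  move=> IH; rewrite cat_uniq => /and3P[us /hasPn su uu] ts.
  have tu : top \notin leaves u' by apply: contraL ts => /su.
  pose v := down_tree u'; have uE : u' = up_tree v by rewrite down_treeK.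
  have uv : uniq (leaves v).
    apply: count_mem_uniq => x; rewrite -count_up_up -uE count_uniq_mem //.
    by rewrite -has_pred1 has_count uE count_up_up -has_count has_pred1.
  have [sE|sN] := eqVneq s' (Leaf top).
    rewrite sE (lie_mon_anti k D Hole) [plug _ _]/= uE lie_mon_top //.
    apply: spanN; rewrite big_seq; elim/big_ind: _ => [|x y|c cv].
    - exact: Spanned0.
    - exact: spannedD.
    by apply: spanned_gen; exists c, v; split=> //; apply: perm_merge_top.
  have := IH (lset s') us ts sN.
  rewrite -(lbr_mon k D (erefl (lset s')) (erefl (lset u'))).
  apply: (spanned_lin_ind (lbr_linearl D (lie_mon k (lset u') u'))) => [|d x y Hx|x].
  - exact: Spanned0.
  - by apply: spannedD; apply: spannedZ.
  case=> c [w [pw cw ->]]; apply: spanned_gen; exists c, (Node w v).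
  have cs : lift top c \in leaves s'.
    by rewrite -(perm_mem pw) -has_pred1 has_count count_up_merge_top -has_count has_pred1.
  have cv : c \notin leaves v.
    apply: contraL cs => cv; apply: su.
    by rewrite -has_pred1 has_count uE count_up_up -has_count has_pred1.
  rewrite /= (tbind_merge_top_out cv) -uE; split.
  - by rewrite perm_cat2r.
  - by rewrite mem_cat cw.
  by rewrite lbr_mon //; apply/setP=> z; rewrite !inE (perm_mem pw).
rewrite /= mem_cat => uN /orP[ts|tu]; first exact: main.
rewrite (lie_mon_anti k D Hole); apply: spanN.
apply: (spanned_lin_ind (F := id) (S := top_merged (D := D) (Node u s))) => //.
- exact: Spanned0.
- by move=> d x y Hx; apply: spannedD; apply: spannedZ.
- move=> x Hx; apply: spanned_gen; apply: top_merged_perm Hx.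
  by rewrite /= perm_catC.
by apply: main => //; rewrite (perm_uniq (permEl (perm_catC _ _))).
Qed.
End TopSpan.

(** * Removing the last point from a shuffling surjection *)

Section Restrict.
Variables (n m : nat) (a : shuf n.+1 m) (c : 'I_n.+1).
Hypothesis ac : a (lift ord_max c) = a ord_max.

(** No value is lost, since [c] takes the value of the removed point; growth survives because the
    removed point precedes no other. *)
Fact restrict_proof : shuffling [ffun x : 'I_n.+1 => a (lift ord_max x)].
Proof.
have /shuffling_growth[sa ga] := valP a; rewrite /= in sa ga.
apply/shuffling_growth; split=> [i|x i].
  have [x <-] := sa i; case: (unliftP ord_max x) => [y ->|->].
    by exists y; rewrite ffunE.
  by exists c; rewrite ffunE.
rewrite ffunE => /ga[y + <-]; case: (unliftP ord_max y) => [z ->|->].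
  by rewrite !lift_max => zx; exists z; rewrite ?ffunE.
by rewrite lift_max /= ltnNge ltnW.
Qed.
Definition restrict : shuf n m := Shuf restrict_proof.

Lemma restrictE x : restrict x = a (lift ord_max x).
Proof. exact: ffunE. Qed.

End Restrict.

Section Unext.
Variables (n m : nat) (a : shuf n.+1 m.+1).
Hypothesis a_top : forall c, a (lift ord_max c) != a ord_max.

(** If the value at the last point were not the largest, growth would give it to a point lying
    before some preimage of the largest value, hence to a second point. *)
Lemma unext_top : a ord_max = ord_max.
Proof.
have /shuffling_growth[sa ga] := valP a; rewrite /= in sa ga.
apply/val_inj/eqP; rewrite /= eqn_leq -ltnS ltn_ord leqNgt; apply/negP=> lt.
have [z az] := sa ord_max; have [|y yz ay] := ga z (a ord_max); first by rewrite az.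
case: (unliftP ord_max y) ay => [x ->|yE _]; first by move/eqP; rewrite (negPf (a_top x)).
by move: yz; rewrite yE /= ltnNge -ltnS ltn_ord.
Qed.

Definition unext_fun : {ffun 'I_n.+1 -> 'I_m.+1} :=
  [ffun x => odflt ord0 (unlift ord_max (a (lift ord_max x)))].

Lemma unext_funE x : lift ord_max (unext_fun x) = a (lift ord_max x).
Proof.
rewrite ffunE; case: unliftP => [y ->//|e].
by have := a_top x; rewrite e unext_top eqxx.
Qed.

Fact unext_proof : shuffling unext_fun.
Proof.
have /shuffling_growth[sa ga] := valP a; rewrite /= in sa ga.
apply/shuffling_growth; split=> [i|x i ix].
  have [x] := sa (lift ord_max i); case: (unliftP ord_max x) => [y ->|->].
    by rewrite -unext_funE => /lift_inj yi; exists y.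
  by rewrite unext_top => /esym/eqP; rewrite up_neq_top.
have [|y] := ga (lift ord_max x) (lift ord_max i).
  by rewrite -unext_funE !lift_max.
case: (unliftP ord_max y) => [z ->|->].
  by rewrite !lift_max -unext_funE => zx /lift_inj zi; exists z.
by rewrite lift_max /= ltnNge ltnW.
Qed.
Definition unext : shuf n m := Shuf unext_proof.

Lemma unextE x : lift ord_max (unext x) = a (lift ord_max x).
Proof. exact: unext_funE. Qed.
End Unext.

Lemma leaf_of_mon1 (T : finType) x (t : tree T) : is_mon [set x] t -> t = Leaf x.
Proof.
case: t => [y|s u] /andP[us /eqP E].
  by move/setP: E => /(_ y); rewrite !inE eqxx => /esym/eqP->.
have : size (leaves (Node s u)) = 1%N.
  by rewrite -(cards1 x) -E -(card_uniqP us); apply: eq_card => y; rewrite inE.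
rewrite /= size_cat => e.
by have := size_leaves s; have := size_leaves u; lia.
Qed.

Lemma is_mon_down n m (b : {ffun 'I_n.+1 -> 'I_m.+1}) (t : tree 'I_n.+2) i D :
  is_mon D t -> ord_max \notin leaves t ->
  (forall x, (lift ord_max x \in D) = (b x == i)) ->
  is_mon (fiber b i) (down_tree t).
Proof.
move=> /is_monP tD tt bD; apply/is_monP=> x.
by rewrite -count_up_up down_treeK // tD bD inE.
Qed.

Lemma mem_mon (T : finType) (D : {set T}) t x : is_mon D t -> (x \in leaves t) = (x \in D).
Proof. by move=> /lset_mon<-; rewrite inE. Qed.

Section Decompose.
Variables (k : comPzRingType) (n m : nat).

(** For a tensor of monomials: if [x_top] is alone in its block, that block is the last one and the
    tensor comes from [adjoin]. Otherwise [top_span] expands the factor containing [x_top], and each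
    term factors through some [merge_top c]. *)
Lemma hom_decompose (z : Hom k n.+1 m.+1) : exists u v,
  z = adjoin u + \sum_c hom_comp (dtop k c) (v c).
Proof.
pose Q (z : Hom k n.+1 m.+1) := exists u v,
  z = adjoin u + \sum_c hom_comp (dtop k c) (v c).
have Q0 : Q 0.
  exists 0, (fun=> 0); rewrite (lin0 (@adjoin_linear _ _ _)) add0r big1 // => c _.
  exact: lin0 (hom_comp_linr _).
have QD d x y : Q x -> Q y -> Q (d *: x + y).
  move=> [u [v ->]] [u' [v' ->]]; exists (d *: u + u'), (fun c => d *: v c + v' c).
  rewrite adjoin_linear scalerDr addrACA; congr (_ + _).
  rewrite scaler_sumr -big_split; apply: eq_bigr => c _.
  by rewrite hom_compPr.
elim/hom_mon_ind: z => // a t ta.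
have [/existsP[c0 /eqP ac0]|] := boolP [exists c, a (lift ord_max c) == a ord_max];
  last first.
  rewrite negb_exists => /forallP atop.
  exists (hom_mon k (unext atop) (fun j => down_tree (t (lift ord_max j)))), (fun=> 0).
  rewrite big1 ?addr0 => [|c _]; last exact: lin0 (hom_comp_linr _).
  have tt j : ord_max \notin leaves (t (lift ord_max j)).
    by rewrite (mem_mon _ (ta _)) inE (unext_top atop) eq_sym up_neq_top.
  rewrite adjoin_mon => [|j]; last first.
    apply: (is_mon_down (b := unext atop) (ta _) (tt j)) => x.
    by rewrite inE -(unextE atop) (inj_eq lift_inj).
  apply: eq_hom_mon => [x|i].
    case: (unliftP ord_max x) => [y ->|->]; first by rewrite ext_up (unextE atop).
    by rewrite ext_top (unext_top atop).
  rewrite /ext_tree; case: unliftP => [j ->|iE]; first by rewrite down_treeK.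
  apply: leaf_of_mon1; suff <- : fiber a i = [set ord_max] by [].
  apply/setP=> x; rewrite !inE iE -{1}(unext_top atop).
  by case: (unliftP ord_max x) => [y ->|->]; rewrite ?eqxx // (negPf (atop y)) up_neq_top.
pose b := restrict ac0; pose p := a ord_max; pose D := fiber a p.
have /andP[utp _] := ta p.
have ttp : ord_max \in leaves (t p) by rewrite (mem_mon _ (ta _)) inE.
have tpN : t p != Leaf ord_max.
  apply/eqP=> e; have := mem_mon (lift ord_max c0) (ta p).
  by rewrite e !inE up_neq_top ac0 eqxx.
have -> : hom_mon k a t = mon_slot (a := a) t (lie_mon k (fiber a p) (t p)).
  by rewrite mon_slot_mon; apply: eq_hom_mon => // i; case: eqP => [->|].
apply: (spanned_lin_ind (@mon_slot_linear k _ _ a t p) Q0 QD _ (top_span k D utp ttp tpN)).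
move=> _ [c [t' [pt' ct' ->]]].
have tp' : is_mon D (tbind (merge_top_tree c) t') by rewrite (is_mon_perm _ pt'); apply: ta.
have bc : b c = p.
  apply/eqP; rewrite restrictE; have := mem_mon (lift ord_max c) tp'; rewrite inE => <-.
  by rewrite -has_pred1 has_count count_up_merge_top -has_count has_pred1.
have tN i : i != p -> ord_max \notin leaves (t i).
  by move=> ip; rewrite (mem_mon _ (ta i)) inE eq_sym.
(* The factors of the preimage: [t'] in the block of [x_top], and the old monomials with renamed
   variables elsewhere. *)
pose s i := if i == p then t' else down_tree (t i).
have sb i : is_mon (fiber b i) (s i).
  rewrite /s; case: eqP => [->|/eqP ip].
    apply/is_monP=> x; rewrite -(count_up_merge_top c); have /is_monP-> := tp'.
    by rewrite !inE restrictE.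
  by apply: (is_mon_down (b := b) (ta i) (tN i ip)) => x; rewrite inE restrictE.
exists 0, (fun d => if d == c then hom_mon k b s else 0).
rewrite (lin0 (@adjoin_linear _ _ _)) add0r (bigD1 c) //= eqxx.
rewrite big1 => [|d /negPf->]; last first.
  exact: lin0 (hom_comp_linr _).
rewrite addr0 mon_slot_mon (hom_comp_mon k (@merge_top_tree_mon n c) sb).
apply: eq_hom_mon => [x|i].
  rewrite shuf_compE; case: (unliftP ord_max x) => [y ->|->].
    by rewrite merge_top_up restrictE.
  by rewrite merge_top_top bc.
rewrite /s; case: eqP => // /eqP ip.
rewrite tbind_merge_top_out ?down_treeK //; first exact: tN.
by have := mem_mon c (sb i); rewrite /s (negPf ip) => ->; rewrite inE bc eq_sym.
Qed.
End Decompose.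

Section Exact.
Variable k : comPzRingType.

Lemma retract_sum n m c (v : 'I_n.+1 -> Hom k n m) :
  retract c (\sum_d hom_comp (dtop k d) (v d)) = v c.
Proof.
rewrite (lin_sum (@retract_linear _ _ _ _)) (eq_bigr (fun d => (d == c)%:R *: v d)).
  rewrite (bigD1 c) //= eqxx scale1r big1 ?addr0 // => d /negPf->.
  exact: scale0r.
by move=> d _; apply: retract_merge_top.
Qed.

(** Of the two parts of the differential of [adjoin u], the retraction kills the adjoined one; the
    other is, up to sign, the sum of all copies of [u], of which it keeps the one at [c]. *)
Lemma retract_diff n m c (u : Hom k n m) :
  retract c (hom_comp (adjoin u) (leib_elt k m.+1)) = (-1) ^+ m.+1 *: u.
Proof.
have sumE : retract c (hom_comp (\sum_(c < n.+1) dtop k c) u) = u.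
  by rewrite (lin_sum (hom_comp_linl u)) (retract_sum c (fun=> u)).
case: m u sumE => [|m] u sumE.
  rewrite leib_elt1 expr1 !scaleN1r -{2}sumE -adjoin_sum_dmor.
  by rewrite -(linN (@retract_linear _ _ c _)) -(linN (hom_comp_linr _)).
rewrite leib_eltS addrC hom_compPr adjoin_sum_dmor retract_linear sumE.
by rewrite adjoin_comp retract_adjoin addr0.
Qed.

(** One point cannot surject onto two or more points. This is the base of the induction. *)
Lemma hom0_eq0 m (z : Hom k 0 m.+1) : z = 0.
Proof.
apply/ffunP=> a; have /shufflingP[_ sa _] := valP a; rewrite /= in sa.
have [x ax] := sa ord0; have [y ay] := sa ord_max.
have xy : x = y by apply/val_inj; case: x {ax} => [[|]] //; case: y {ay} => [[|]].
by have := congr1 val ay; rewrite -xy ax.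
Qed.

Lemma leib_exact n m (z : Hom k n m.+1) : hom_comp z (leib_elt k m.+1) = 0 ->
  exists y, z = hom_comp y (leib_elt k m.+2).
Proof.
elim: n m z => [|n IH] m z.
  by move=> _; exists 0; rewrite (hom0_eq0 z) (lin0 (hom_comp_linl _)).
have [u [v ->]] := hom_decompose z.
pose sgn : k := (-1) ^+ m.+1.
have sgn2 : sgn * sgn = 1 by rewrite -expr2 sqrr_sign.
have sgnS : (-1) ^+ m.+2 = - sgn by rewrite exprS mulN1r.
move=> dz.
have dv c : hom_comp (v c) (leib_elt k m.+1) = - (sgn *: u).
  have := congr1 (fun x : Hom k n.+1 m => retract c x) dz; rewrite /=.
  rewrite (lin0 (@retract_linear _ _ _ _)) (linD (hom_comp_linl _)).
  rewrite (linD (@retract_linear _ _ _ _)).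
  rewrite retract_diff (lin_sum (hom_comp_linl _)).
  rewrite (eq_bigr (fun d => hom_comp (dtop k d)
    (hom_comp (v d) (leib_elt k m.+1)))) => [|d _]; last exact: hom_compA.
  by rewrite retract_sum addrC => /eqP; rewrite addr_eq0 => /eqP.
(* The differential of [v c] is the same for all [c], so these differences are cycles over [[n]]. *)
have /fin_all_exists[w wE] c : exists w, v c - v ord0 = hom_comp w (leib_elt k m.+2).
  by apply: IH; rewrite (linB (hom_comp_linl _)) !dv subrr.
(* The factor [sgn] cancels the sign in [dv], and both terms on the right come out with a minus
   sign. *)
have dI : sgn *: hom_comp (adjoin (v ord0)) (leib_elt k m.+2) =
    - adjoin u - \sum_c hom_comp (dtop k c) (v ord0).
  rewrite leib_eltS (linD (hom_comp_linr _)) adjoin_comp dv (linZ (hom_comp_linr _)).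
  rewrite adjoin_sum_dmor (lin_sum (hom_comp_linl _)) (linN (@adjoin_linear _ _ _)).
  rewrite (linZ (@adjoin_linear _ _ _)) sgnS scalerDr scalerN scaleNr scalerN !scalerA.
  by rewrite sgn2 !scale1r.
(* The first sum bounds the copies of the [v c - v ord0]; by [dI] the second term restores
   [adjoin u] and the copies of [v ord0]. *)
exists (\sum_c hom_comp (dtop k c) (w c) - sgn *: adjoin (v ord0)).
rewrite (linB (hom_comp_linl _)) (linZ (hom_comp_linl _)) dI opprD !opprK addrCA.
congr (_ + _); rewrite (lin_sum (hom_comp_linl _)) -big_split; apply: eq_bigr => c _ /=.
by rewrite hom_compA -wE (linB (hom_comp_linr _)) subrK.
Qed.
End Exact.

Theorem proposition4p1 (k : comPzRingType) (i n : nat) (hi : (0 < i)%N) :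
  forall x : leib_homology (representable k n) i, x = 0.
Proof.
case: i hi => // m _ x; rewrite -[x]quot_reprK -(raddf0 (quot_pi _)).
case: (quot_repr x) => z dz; apply/quot_piP; rewrite subr0; apply: spanned_gen.
have [|y zE] := @leib_exact k n m z; first exact: (eqP dz).
by exists y; rewrite /= zE.
Qed.
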